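(* Let $Q=\{961,1024,1369,1681,2401\}$. In $PG(2,q)$ ($q$ a prime power) the following hold: $t_2(2,q)<4\sqrt{q}$ for $2\le q\le 841$, $q=857$, and $q\in Q$; $t_2(2,q)\le 3\sqrt{q}$ for $2\le q\le 89$ and $q=101$; $t_2(2,q)<3.5\sqrt{q}$ for $2\le q\le 277$; $t_2(2,q)<3.6\sqrt{q}$ for $2\le q\le 349$ and $q=359,661$; $t_2(2,q)<3.7\sqrt{q}$ for $2\le q\le 419$ and $q=601,661$; $t_2(2,q)<3.8\sqrt{q}$ for $2\le q\le 541$ and $q=601,661$; $t_2(2,q)<3.9\sqrt{q}$ for $2\le q\le 673$ and $q=729,961,1024$. Moreover: $t_2(2,q)\le 4\sqrt{q}-9$ for $37\le q\le 211$ and $q=23,227,229,233,241,243,256,257,661$; $t_2(2,q)\le 4\sqrt{q}-8$ for $23\le q\le 307$ and $q=317,343,601,661$; $t_2(2,q)\le 4\sqrt{q}-7$ for $19\le q\le 373$ and $q=383,401,601,661$; $t_2(2,q)\le 4\sqrt{q}-6$ for $9\le q\le 433$ and $q=443,463,601,661$; $t_2(2,q)\le 4\sqrt{q}-5$ for $8\le q\le 499$ and $q=509,512,521,523,529,541,601,661$; $t_2(2,q)\le 4\sqrt{q}-4$ for $7\le q\le 557$ and $q=569,571,577,601,625,661,729,841$, and $q\in Q$; $t_2(2,q)<4\sqrt{q}-3$ for $7\le q\le 643$ and $q=653,661,729,841$, and $q\in Q$; $t_2(2,q)\le 4\sqrt{q}-2$ for $3\le q\le 691$ and $q=709,719,729,841$,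 and $q\in Q$; $t_2(2,q)<4\sqrt{q}-1$ for $2\le q\le 761$ and $q=773,787,841$, and $q\in Q$.
   Context: $PG(2,q)$ is the projective plane over the finite field $\mathbb{F}_q$, $q$ a prime power; all ranges of $q$ are over prime powers. An $n$-arc is a set of $n$ points of $PG(2,q)$ no three of which are collinear; it is complete if it is not contained in an $(n+1)$-arc of $PG(2,q)$. $t_2(2,q)$ is the smallest size of a complete arc in $PG(2,q)$. *)

(* Defs.v *)
From HB Require Import structures.
From mathcomp Require Import all_boot all_order all_algebra all_field.
Set Implicit Arguments. Unset Strict Implicit. Unset Printing Implicit Defensive.
Import Order.TTheory GRing.Theory Num.Theory.

Local Open Scope ring_scope.
Section PG2.
Variable F : finFieldType.

(* A point of PG(2,F) is represented by its unique normalized homogeneous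
   coordinate vector: nonzero, with first nonzero coordinate equal to 1. *)
Definition normalized (v : 'rV[F]_3) : bool :=
  [exists i : 'I_3, (v ord0 i == 1) && [forall j : 'I_3, (j < i)%N ==> (v ord0 j == 0)]].

Definition pg2_point := {v : 'rV[F]_3 | normalized v}.

Definition collinear (a b c : pg2_point) : bool :=
  \det (\matrix_(i < 3, j < 3) (nth 0 [:: val a; val b; val c] i) ord0 j) == 0.

Definition is_arc (A : {set pg2_point}) : bool :=
  [forall a in A, forall b in A, forall c in A,
     [&& a != b, a != c & b != c] ==> ~~ collinear a b c].

Definition complete_arc (A : {set pg2_point}) : bool :=
  is_arc A && [forall x, (x \notin A) ==> ~~ is_arc (x |: A)].

(* t_2(2,q): smallest size of a complete arc (the default value #|points|+1
   is never attained since complete arcs exist). *)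
Definition t2 : nat :=
  \big[minn/#|{: pg2_point}|.+1]_(A : {set pg2_point} | complete_arc A) #|A|.
End PG2.

Definition Qset : seq nat := [:: 961; 1024; 1369; 1681; 2401].

(* Main.v *)
From Stdlib Require Import NArith FMapPositive.
Require Import Defs.
From HB Require Import structures.
From mathcomp Require Import all_boot all_order all_algebra all_field.
From mathcomp Require Import zify ring.
Set Implicit Arguments. Unset Strict Implicit. Unset Printing Implicit Defensive.
Import Order.TTheory GRing.Theory Num.Theory.

(** For every q in the range there is a small complete arc invariant under a
    cyclic group of projectivities (x : y : z) -> (-D y : x + t y : e z).  The
    arcs come from a computer search and are verified here by computation.

    The line x = 0 misses each arc, so its points can be written (1 : a : b).  The group
    fixes the point (0 : 0 : 1) and permutes the lines y = u x through it; hence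
    only one such line per orbit has to be shown to be covered by secants.

    A field element is coded by its logarithm to a primitive element theta (0 by
    0, theta^i by i + 1), where theta is a root of f = X^h - sum r_i X^i; it
    exists because multiplication by X modulo f has order dividing q - 1, so
    that f divides X^q - X.  The points joined to an arc point P = (1 : a : b)
    along a common line are recognized by the slope of the line, and with
    coordinates u/a - 1 and w/b - 1 around P the logarithm of the normalized
    slope is a difference of two table entries.  For each P the slopes of the
    secants through P are kept in a base 4 trie, doubled to avoid a reduction
    modulo q - 1.

    The inequalities with square roots are squared into inequalities of natural
    numbers. *)

(** [t2 F] must be bounded for every finite field of the given order, while a certificate is a list
    of numbers. Hence theta is a root of f found inside the given F, and the logarithm tables are
    proved correct for that root.

    The slopes seen from an arc point P serve twice. If none is repeated, no two other arc points
    are collinear with P, which is the arc property; and the same set of slopes tells whether a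
    point of the plane lies on a secant through P.

    This last test dominates the cost. For fixed P = (1 : a : b) the normalization multiplies all
    slopes through P by one constant, so it preserves equality of slopes, and it makes the table for
    any a a rotation of the single table of x - 1. The columns hold 1/u' instead of u', where u' and
    w' are the normalized coordinates. The difference of logarithms thus becomes a sum i + j with i,
    j < q - 1, and the trie is descended along the digits of both summands with a carry.

    The lines through (0 : 0 : 1) are kept apart: such a line containing two arc points is itself a
    secant and is covered at once, and otherwise no secant is vertical on it. *)

(** * Base 4 digits and tries *)

Inductive dig := De | D0 of dig | D1 of dig | D2 of dig | D3 of dig.
Inductive trie := Lf of bool | Nd of trie & trie & trie & trie.

(* Membership of a + b, resp. a + b + 1, without computing the sum. *)
Fixpoint add_mem (t : trie) (a b : dig) : bool :=
  match t with
  | Lf x => x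
  | Nd t0 t1 t2 t3 =>
    match a with
    | De => false
    | D0 a => match b with De => false | D0 b => add_mem t0 a b | D1 b => add_mem t1 a b
                         | D2 b => add_mem t2 a b | D3 b => add_mem t3 a b end
    | D1 a => match b with De => false | D0 b => add_mem t1 a b | D1 b => add_mem t2 a b
                         | D2 b => add_mem t3 a b | D3 b => addc_mem t0 a b end
    | D2 a => match b with De => false | D0 b => add_mem t2 a b | D1 b => add_mem t3 a b
                         | D2 b => addc_mem t0 a b | D3 b => addc_mem t1 a b end
    | D3 a => match b with De => false | D0 b => add_mem t3 a b | D1 b => addc_mem t0 a b
                         | D2 b => addc_mem t1 a b | D3 b => addc_mem t2 a b end
    end
  end
with addc_mem (t : trie) (a b : dig) : bool :=
  match t with
  | Lf x => x
  | Nd t0 t1 t2 t3 =>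
    match a with
    | De => false
    | D0 a => match b with De => false | D0 b => add_mem t1 a b | D1 b => add_mem t2 a b
                         | D2 b => add_mem t3 a b | D3 b => addc_mem t0 a b end
    | D1 a => match b with De => false | D0 b => add_mem t2 a b | D1 b => add_mem t3 a b
                         | D2 b => addc_mem t0 a b | D3 b => addc_mem t1 a b end
    | D2 a => match b with De => false | D0 b => add_mem t3 a b | D1 b => addc_mem t0 a b
                         | D2 b => addc_mem t1 a b | D3 b => addc_mem t2 a b end
    | D3 a => match b with De => false | D0 b => addc_mem t0 a b | D1 b => addc_mem t1 a b
                         | D2 b => addc_mem t2 a b | D3 b => addc_mem t3 a b end
    end
  end.

Fixpoint tset (t : trie) (d : dig) : trie :=
  match d with
  | De => Lf true
  | D0 d => match t with Nd t0 t1 t2 t3 => Nd (tset t0 d) t1 t2 t3 | Lf x => Nd (tset (Lf x) d) (Lf x) (Lf x) (Lf x) end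
  | D1 d => match t with Nd t0 t1 t2 t3 => Nd t0 (tset t1 d) t2 t3 | Lf x => Nd (Lf x) (tset (Lf x) d) (Lf x) (Lf x) end
  | D2 d => match t with Nd t0 t1 t2 t3 => Nd t0 t1 (tset t2 d) t3 | Lf x => Nd (Lf x) (Lf x) (tset (Lf x) d) (Lf x) end
  | D3 d => match t with Nd t0 t1 t2 t3 => Nd t0 t1 t2 (tset t3 d) | Lf x => Nd (Lf x) (Lf x) (Lf x) (tset (Lf x) d) end
  end.

(** Least significant digit first, padded or cut to exactly [nd] digits, so that two logarithms and
    a trie can be descended in lockstep. *)
Fixpoint enc (nd : nat) (n : N) : dig :=
  if nd is nd'.+1 then
    match n with
    | N0 => D0 (enc nd' N0)
    | Npos xH => D1 (enc nd' N0)
    | Npos (xO xH) => D2 (enc nd' N0)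
    | Npos (xI xH) => D3 (enc nd' N0)
    | Npos (xO (xO p)) => D0 (enc nd' (Npos p))
    | Npos (xI (xO p)) => D1 (enc nd' (Npos p))
    | Npos (xO (xI p)) => D2 (enc nd' (Npos p))
    | Npos (xI (xI p)) => D3 (enc nd' (Npos p))
    end
  else De.

(* A logarithm in base 4 and in binary; [Z] stands for the field element 0. *)
Inductive dlog := Z | Lg of dig & N.

Definition dlog_of (nd : nat) (x : N) : dlog :=
  if x is Npos _ then let i := N.pred x in Lg (enc nd i) i else Z.

Fixpoint dlen (d : dig) : nat :=
  match d with De => 0 | D0 d | D1 d | D2 d | D3 d => (dlen d).+1 end.

Fixpoint dval (d : dig) : nat :=
  match d with
  | De => 0
  | D0 d => 0 + 4 * dval d
  | D1 d => 1 + 4 * dval d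
  | D2 d => 2 + 4 * dval d
  | D3 d => 3 + 4 * dval d
  end.

Fixpoint tget (t : trie) (n : nat) : bool :=
  match t with
  | Lf x => x
  | Nd t0 t1 t2 t3 =>
    match n %% 4 with
    | 0 => tget t0 (n %/ 4)
    | 1 => tget t1 (n %/ 4)
    | 2 => tget t2 (n %/ 4)
    | _ => tget t3 (n %/ 4)
    end
  end.

(** [Lf false] may stand for an empty subtree at any depth, but [Lf true] only occurs after all [k]
    digits; higher up it would put a whole residue class into the set. *)
Fixpoint wft (k : nat) (t : trie) : bool :=
  match t, k with
  | Lf x, _ => x ==> (k == 0)
  | Nd t0 t1 t2 t3, k.+1 => [&& wft k t0, wft k t1, wft k t2 & wft k t3]
  | Nd _ _ _ _, 0 => false
  end.

Lemma tget_Lf x n : tget (Lf x) n = x. Proof. by []. Qed.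

Lemma tget_Nd t0 t1 t2 t3 i n : i < 4 ->
  tget (Nd t0 t1 t2 t3) (i + 4 * n) = tget (nth t0 [:: t0; t1; t2; t3] i) n.
Proof.
move=> lt_i4.
have em : (i + 4 * n) %% 4 = i by rewrite addnC mulnC modnMDl modn_small.
have ed : (i + 4 * n) %/ 4 = n by rewrite addnC mulnC divnMDl // divn_small ?addn0.
by rewrite /= em ed; case: i lt_i4 {em ed} => [|[|[|[|i]]]].
Qed.

Local Arguments tget : simpl never.

(** Both claims go through one induction because a carry switches between the two functions. No
    bound on the sum appears: [tget] also reads only as many digits as the trie has, so a final
    carry is dropped on both sides. *)
Lemma add_memE k t a b : wft k t -> dlen a = k -> dlen b = k ->
  add_mem t a b = tget t (dval a + dval b)
  /\ addc_mem t a b = tget t (dval a + dval b).+1.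
Proof.
elim: t k a b => [x|t0 IH0 t1 IH1 t2 IH2 t3 IH3] [|k] a b //=.
case/and4P=> /IH0 {}IH0 /IH1 {}IH1 /IH2 {}IH2 /IH3 {}IH3.
have split4 n i m : n = i + 4 * m -> i < 4 ->
    tget (Nd t0 t1 t2 t3) n = tget (nth t0 [:: t0; t1; t2; t3] i) m.
  by move=> -> /tget_Nd.
case: a => [|a|a|a|a] //= [la]; case: b => [|b|b|b|b] //= [lb];
have [e0 c0] := IH0 a b la lb; have [e1 c1] := IH1 a b la lb;
have [e2 c2] := IH2 a b la lb; have [e3 c3] := IH3 a b la lb;
rewrite ?e0 ?e1 ?e2 ?e3 ?c0 ?c1 ?c2 ?c3;
(* The subtree selected by the function tells the low digit of the sum. Reading [tget_Nd] backwards
   turns both sides into lookups in the same node, which leaves an identity between sums. *)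
split; match goal with |- tget ?t ?X = _ =>
  match t with
  | t0 => rewrite -[tget t0 X](@tget_Nd t0 t1 t2 t3 0 X isT)
  | t1 => rewrite -[tget t1 X](@tget_Nd t0 t1 t2 t3 1 X isT)
  | t2 => rewrite -[tget t2 X](@tget_Nd t0 t1 t2 t3 2 X isT)
  | t3 => rewrite -[tget t3 X](@tget_Nd t0 t1 t2 t3 3 X isT)
  end end; congr (tget _ _); clear; lia.
Qed.

Lemma tset_wf k t d : wft k t -> dlen d = k -> wft k (tset t d).
Proof.
elim: d k t => [|d IH|d IH|d IH|d IH] [|k] [x|t0 t1 t2 t3] //=.
all: try by case/and4P=> w0 w1 w2 w3 [ld]; rewrite ?w0 ?w1 ?w2 ?w3 ?IH //.
all: by case: x => // _ [ld]; rewrite IH //; case: (k).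
Qed.

Lemma modn_exp4 n k : n %% 4 ^ k.+1 = n %% 4 + 4 * ((n %/ 4) %% 4 ^ k).
Proof.
rewrite expnS [in LHS](divn_eq n 4) mulnC [n %% 4 + _]addnC.
rewrite {1}(divn_eq (n %/ 4) (4 ^ k)) mulnDr mulnCA -addnA modnMDl modn_small //.
have := ltn_pmod n (isT : 0 < 4).
have : (n %/ 4) %% 4 ^ k < 4 ^ k by rewrite ltn_pmod ?expn_gt0.
by lia.
Qed.

Lemma tget_tset k t d n : wft k t -> dlen d = k ->
  tget (tset t d) n = tget t n || (n %% 4 ^ k == dval d).
Proof.
elim: d k t n => [|d IH|d IH|d IH|d IH] [|k] [x|t0 t1 t2 t3] n //.
  by move=> _ _; rewrite modn1 eqxx orbT.
all: rewrite modn_exp4 [dlen _]/= [in tget _ n](divn_eq n 4) [in X in _ = X || _](divn_eq n 4).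
all: rewrite mulnC addnC; set m := n %/ 4; set r := m %% 4 ^ k.
all: have lt4 : n %% 4 < 4 by rewrite ltn_pmod.
all: move=> wt [ld].
all: have {}IH t' : wft k t' -> tget (tset t' d) m = tget t' m || (r == dval d)
  by move=> wt'; apply: IH.
all: have wLf : wft k (Lf false) by case: (k).
all: move: wt; clearbody r m; move: lt4; move: (n %% 4) => i lt4 /=.
all: try (case: x => [/implyP/(_ isT) //|_]).
all: try (case/and4P=> w0 w1 w2 w3).
all: rewrite !tget_Nd // ?tget_Lf.
all: case: i lt4 => [|[|[|[|//]]]] _ /=.
all: rewrite ?IH // ?tget_Lf ?orFb; try by congr (_ || _); clear; lia.
all: try by apply/esym/orb_idr => /eqP; clear; lia.
all: by clear; lia.
Qed.

Lemma dlen_enc k n : dlen (enc k n) = k.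
Proof. by elim: k n => //= k IH [|[[p|p|]|[p|p|]|]] /=; rewrite IH. Qed.

Lemma dval_enc k n : dval (enc k n) = N.to_nat n %% 4 ^ k.
Proof.
elim: k n => [|k IH] n; first by rewrite modn1.
rewrite modn_exp4.
case: n => [|[[p|p|]|[p|p|]|]]; rewrite [enc _ _]/= [dval _]/= IH;
match goal with |- ?i + 4 * (?a %% _) = ?b %% 4 + _ =>
  have [-> ->] : b %% 4 = i /\ b %/ 4 = a by lia end; done.
Qed.

(** * Directions seen from one arc point *)

(** The trie holds the logarithms of finite nonzero slopes. The flags record the slope 0, the
    vertical direction and the arc point itself. [Bad] means that a class came twice: three
    collinear arc points, or a repeated point. *)
Inductive dirs := Bad | Dirs of trie & bool & bool & bool.

Section Plane.
Variables (nd : nat) (m : N).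

(** The class of [k] modulo [m] has two representatives below 2m, [k] and [k] shifted by [m]. Both
    are inserted, so that later lookups need no reduction. Adding [enc nd N0] makes [add_mem] a
    plain lookup. *)
Definition add_dir (t : dirs) (c l : dlog) : dirs :=
  if t isn't Dirs t z v s then Bad else
  match c, l with
  | Z, Z => if s then Bad else Dirs t z v true
  | Z, Lg _ _ => if v then Bad else Dirs t z true s
  | Lg _ _, Z => if z then Bad else Dirs t true v s
  | Lg _ i, Lg _ j =>
    let k := N.add i j in
    let d := enc nd k in
    if add_mem t d (enc nd N0) then Bad
    else Dirs (tset (tset t d) (enc nd (if N.ltb k m then N.add k m else N.sub k m))) z v s
  end.

Fixpoint add_dirs (ts : seq dirs) (cs ls : seq dlog) : seq dirs :=
  match ts, cs, ls with
  | t :: ts, c :: cs, l :: ls => add_dir t c l :: add_dirs ts cs ls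
  | _, _, _ => [::]
  end.

(** A point equal to an arc point counts as covered. Vertical directions are passed over here, since
    [column_ok] deals with them for a whole line at a time. *)
Fixpoint covered (ts : seq dirs) (cs ls : seq dlog) : bool :=
  match ts with
  | [::] => false
  | t :: ts =>
    match cs with
    | [::] => false
    | c :: cs =>
      match ls with
      | [::] => false
      | l :: ls =>
        match c with
        | Z => match l with Z => true | Lg _ _ => covered ts cs ls end
        | Lg c _ =>
          match t with
          | Bad => false
          | Dirs t z _ _ =>
            match l with
            | Z => if z then true else covered ts cs ls
            | Lg l _ => if add_mem t c l then true else covered ts cs ls
            end
          end
        end
      end
    end
  end.

Fixpoint all_covered (ts : seq dirs) (cs : seq dlog) (rows : seq (seq dlog)) : bool :=
  if rows is ls :: rows then if covered ts cs ls then all_covered ts cs rows else false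
  else true.

Definition isZ c := if c is Z then true else false.

(** An entry [Z] marks an arc point on the line y = u x. Two of them make this line a secant, which
    covers all its affine points. *)
Definition column_ok ts cs rows := if 1 < count isZ cs then true else all_covered ts cs rows.
End Plane.

Section Directions.
Variables (nd : nat) (m : N).
Let mm := N.to_nat m.
Hypothesis m_gt0 : 0 < mm.
Hypothesis nd_large : 2 * mm <= 4 ^ nd.

Definition wf_dlog (x : dlog) : Prop :=
  match x with Z => True | Lg d i => d = enc nd i /\ N.to_nat i < mm end.

(* For (1/u', w') the class of a direction: the logarithm of a finite nonzero
   slope, then the codes of slope 0, of the vertical direction, and of no direction. *)
Definition cls (p : dlog * dlog) : nat :=
  match p with
  | (Lg _ i, Lg _ j) => (N.to_nat i + N.to_nat j) %% mm
  | (Lg _ _, Z) => mm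
  | (Z, Lg _ _) => mm.+1
  | (Z, Z) => mm.+2
  end.

(** [S] lists the classes of the points added so far, in order. Its being duplicate-free is the arc
    property as seen from one point. *)
Definition dirs_inv (t : dirs) (S : seq nat) : Prop :=
  if t isn't Dirs t z v s then False else
  [/\ wft nd t, forall n, n < 2 * mm -> tget t n = (n %% mm \in S),
      [/\ z = (mm \in S), v = (mm.+1 \in S) & s = (mm.+2 \in S)] & uniq S].

Lemma dirs_inv0 : dirs_inv (Dirs (Lf false) false false false) [::].
Proof. by split=> //; case: nd. Qed.

Lemma add_memP t i j : wft nd t -> N.to_nat i < mm -> N.to_nat j < mm ->
  add_mem t (enc nd i) (enc nd j) = tget t (N.to_nat i + N.to_nat j).
Proof.
move=> wt lti ltj; have [-> _] := add_memE wt (dlen_enc nd i) (dlen_enc nd j).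
by rewrite !dval_enc !modn_small //; lia.
Qed.

Lemma add_dirP t S c l : dirs_inv t S -> wf_dlog c -> wf_dlog l ->
  add_dir nd m t c l = Bad \/ dirs_inv (add_dir nd m t c l) (rcons S (cls (c, l))).
Proof.
case: t => // t z v s [wt tgetS [ez ev es] uS] wc wl.
have rconsS x : x \notin S -> uniq (rcons S x) by move=> xS; rewrite rcons_uniq xS.
have ltS n : n %% mm < mm by rewrite ltn_mod.
case: c l wc wl => [|dc i] [|dl j] /=.
- case: s es => es _ _; [by left | right].
  split=> //; rewrite ?mem_rcons ?inE ?rconsS -?es //.
    by move=> n lt_n; rewrite tgetS // mem_rcons inE; have := ltS n; case: eqP => // ->; lia.
  by rewrite ?mem_rcons ?inE -ez -ev; split=> //; lia.
- case: v ev => ev _ _; [by left | right].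
  split=> //; rewrite ?mem_rcons ?inE ?rconsS -?ev //.
    by move=> n lt_n; rewrite tgetS // mem_rcons inE; have := ltS n; case: eqP => // ->; lia.
  by rewrite ?mem_rcons ?inE -ez -es; split=> //; lia.
- case: z ez => ez _ _; [by left | right].
  split=> //; rewrite ?mem_rcons ?inE ?rconsS -?ez //.
    by move=> n lt_n; rewrite tgetS // mem_rcons inE; have := ltS n; case: eqP => // ->; lia.
  by rewrite ?mem_rcons ?inE -ev -es; split=> //; lia.
case=> _ lti [_ ltj].
set k := N.add i j.
have ek : N.to_nat k = N.to_nat i + N.to_nat j by rewrite /k; lia.
have ltk : N.to_nat k < 2 * mm by lia.
have [-> _] := add_memE wt (dlen_enc nd k) (dlen_enc nd 0).
have -> : dval (enc nd k) + dval (enc nd 0) = N.to_nat k.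
  by rewrite !dval_enc mod0n addn0 modn_small //; lia.
rewrite tgetS // -ek; have [kS|kS] := boolP (_ \in S); [by left | right].
set k' := if N.ltb k m then _ else _.
have ek' : N.to_nat k' = if N.to_nat k < mm then N.to_nat k + mm else N.to_nat k - mm.
  by rewrite /k'; case: N.ltb_spec; case: ltnP; rewrite /mm; clear; lia.
have ltk' : N.to_nat k' < 2 * mm by rewrite ek'; move: ltk; clear; case: ifP; lia.
have w1 : wft nd (tset t (enc nd k)) by rewrite tset_wf ?dlen_enc.
split; rewrite ?tset_wf ?dlen_enc ?rconsS //.
  move=> n lt_n; rewrite !(tget_tset _ (k := nd)) ?dlen_enc // tgetS //.
  (* All sums stay below 2m, which is at most 4 ^ nd, so no digit is lost. *)
  have sz x : x < 2 * mm -> x %% 4 ^ nd = x.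
    by move=> ltx; rewrite modn_small // (leq_trans ltx).
  rewrite !dval_enc !sz // ?mem_rcons ?inE.
  rewrite -orbA orbC; congr (_ || _).
    have modE x : x < 2 * mm -> x %% mm = if x < mm then x else x - mm.
      by move=> ltx; case: ltnP => lt; [rewrite modn_small |
        rewrite -{1}(subnK lt) modnDr modn_small //; move: ltx lt; clear; lia].
    by rewrite !modE // ek'; clear -ltk lt_n; do 2!case: ltnP => ?; lia.
rewrite ?mem_rcons ?inE -ez -ev -es.
have ltSk := ltS (N.to_nat k).
have ne x : mm <= x -> (x == N.to_nat k %% mm) = false.
  by move=> le_x; apply/gtn_eqF/(leq_trans ltSk).
by rewrite !ne // ltnW.
Qed.
End Directions.

Lemma size_add_dirs nd m ts cs ls : size cs = size ts -> size ls = size ts ->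
  size (add_dirs nd m ts cs ls) = size ts.
Proof. by elim: ts cs ls => [|t ts IH] [|c cs] [|l ls] //= [sc] [sl]; rewrite IH. Qed.

Lemma nth_add_dirs nd m ts cs ls i : size cs = size ts -> size ls = size ts ->
  i < size ts ->
  nth Bad (add_dirs nd m ts cs ls) i =
  add_dir nd m (nth Bad ts i) (nth Z cs i) (nth Z ls i).
Proof.
by elim: ts cs ls i => [|t ts IH] [|c cs] [|l ls] // [|i] //= [sc] [sl] lti; rewrite IH.
Qed.

(** The records of all arc points grow together, one added point at a time. Seen at a single index,
    the process is a fold over that record alone, to which [fold_add_dirP] applies. *)
Lemma nth_fold_add_dirs nd m (T : eqType) (f g : T -> seq dlog) (K : seq T) ts i :
  i < size ts ->
  {in K, forall x, size (f x) = size ts /\ size (g x) = size ts} ->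
  nth Bad (foldl (fun ts x => add_dirs nd m ts (f x) (g x)) ts K) i =
  foldl (fun t x => add_dir nd m t (nth Z (f x) i) (nth Z (g x) i)) (nth Bad ts i) K.
Proof.
elim: K ts => //= x K IH ts lti szK.
have [sf sg] := szK x (mem_head _ _).
rewrite IH ?size_add_dirs // ?nth_add_dirs // => y yK; apply: szK.
by rewrite inE yK orbT.
Qed.

Lemma size_fold_add_dirs nd m (T : eqType) (f g : T -> seq dlog) (K : seq T) ts :
  {in K, forall x, size (f x) = size ts /\ size (g x) = size ts} ->
  size (foldl (fun ts x => add_dirs nd m ts (f x) (g x)) ts K) = size ts.
Proof.
elim: K ts => //= x K IH ts szK; have [sf sg] := szK x (mem_head _ _).
rewrite IH size_add_dirs // => y yK; apply: szK.
by rewrite inE yK orbT.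
Qed.

Lemma fold_add_dirP nd m (T : eqType) (f g : T -> dlog) (K : seq T) :
  0 < N.to_nat m -> 2 * N.to_nat m <= 4 ^ nd ->
  {in K, forall x, wf_dlog nd m (f x) /\ wf_dlog nd m (g x)} ->
  let t := foldl (fun t x => add_dir nd m t (f x) (g x)) (Dirs (Lf false) false false false) K in
  t <> Bad -> dirs_inv nd m t [seq cls m (f x, g x) | x <- K].
Proof.
move=> m_gt0 le_nd; elim/last_ind: K => [|K x IH] wfK /=; first by move=> _; apply: dirs_inv0.
rewrite foldl_rcons map_rcons; set t := foldl _ _ K in IH *.
have [wf wg] : wf_dlog nd m (f x) /\ wf_dlog nd m (g x).
  by apply: wfK; rewrite mem_rcons mem_head.
(* [Bad] is absorbing, so a good final record was good at every stage. *)
have [tB | tnB] : t = Bad \/ t <> Bad by case: (t); [left | right].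
  by rewrite tB.
case: (add_dirP m_gt0 le_nd (IH _ tnB) wf wg) => // y yK; apply: wfK.
by rewrite mem_rcons inE yK orbT.
Qed.

(** The bound on the class matters: [S i] also contains the code m + 2 of the arc point itself, and
    membership of that code would not provide a second point on the line. *)
Lemma coveredP nd m ts cs ls (S : nat -> seq nat) :
  0 < N.to_nat m -> 2 * N.to_nat m <= 4 ^ nd ->
  size cs = size ts -> size ls = size ts ->
  (forall i, i < size ts -> dirs_inv nd m (nth Bad ts i) (S i)) ->
  (forall i, i < size ts -> wf_dlog nd m (nth Z cs i) /\ wf_dlog nd m (nth Z ls i)) ->
  covered ts cs ls ->
  exists2 i, i < size ts & let x := cls m (nth Z cs i, nth Z ls i) in
    x = (N.to_nat m).+2 \/ x <= N.to_nat m /\ x \in S i.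
Proof.
move=> m_gt0 le_nd; elim: ts cs ls S => [|t ts IH] [|c cs] [|l ls] S //= [sc] [sl] inv wf.
have next : covered ts cs ls -> exists2 i, i < (size ts).+1 &
    let x := cls m (nth Z (c :: cs) i, nth Z (l :: ls) i) in
    x = (N.to_nat m).+2 \/ x <= N.to_nat m /\ x \in S i.
  move/(IH cs ls (fun i => S i.+1)) => IH'; case: IH' => // [i lti|i lti|i lti h].
  - exact: (inv i.+1).
  - exact: (wf i.+1).
  - by exists i.+1.
have /= inv0 := inv 0 isT; have [/= wfc wfl] := wf 0 isT.
case: c wfc next {wf} => [|dc i] wfc next.
  by case: l wfl next => [_ _ _|dl j _ h hc]; [exists 0 => //; left | exact: h].
case: t inv0 {inv} => // t z v s [wt tgetS [ez _ _] _].
case: l wfl next => [_|dl j] next.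
  case: z ez => [ez _|_ h]; last exact: next.
  by exists 0 => //=; right; rewrite -ez.
case: wfc next => -> lti [-> ltj] next; rewrite (add_memP m_gt0 le_nd) // tgetS; last by lia.
case: ifP => [inS _|_ h]; last exact: next.
exists 0 => //=; right; split=> //.
by rewrite ltnW // ltn_mod.
Qed.

(** * Equal classes and parallel vectors over a field *)

Section Geometry.
Local Open Scope ring_scope.
Variables (F : fieldType) (th : F) (nd : nat) (m : N).
Let mm := N.to_nat m.
Hypothesis m_gt0 : (0 < mm)%N.
Hypothesis th_m : th ^+ mm = 1.
Hypothesis th_inj : forall i j, (i < mm)%N -> (j < mm)%N -> th ^+ i = th ^+ j -> i = j.

Definition lval (x : dlog) : F := if x is Lg _ i then th ^+ N.to_nat i else 0.

Lemma th_neq0 : th != 0.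
Proof.
by apply/eqP => th0; move: th_m; rewrite th0 expr0n gtn_eqF // => /eqP; rewrite eq_sym oner_eq0.
Qed.

(** Since [lval c] is the inverse of a first coordinate, with 0 for 0, the equation is the vanishing
    of the determinant of two vectors. *)
Lemma cls_parallel c l c' l' : cls m (c, l) = cls m (c', l') ->
  (lval c)^-1 * lval l' = (lval c')^-1 * lval l.
Proof.
have ltm k : (k %% mm < mm)%N by rewrite ltn_mod.
have th_mod k : th ^+ (k %% mm) = th ^+ k by rewrite expr_mod.
case: c l c' l' => [|dc i] [|dl j] [|dc' i'] [|dl' j'] //=;
  rewrite ?invr0 ?(mul0r, mulr0) //; try by [have := ltm (N.to_nat i + N.to_nat j)%N; lia
  | have := ltm (N.to_nat i' + N.to_nat j')%N; lia | lia].
move=> e; have {}e : th ^+ (N.to_nat i + N.to_nat j) = th ^+ (N.to_nat i' + N.to_nat j').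
  by rewrite -th_mod e th_mod.
rewrite !exprD in e.
have nz k : th ^+ k != 0 by rewrite expf_neq0 ?th_neq0.
have := nz (N.to_nat i); have := nz (N.to_nat i'); move=> n1 n2.
by apply: (mulfI n1); apply: (mulfI n2); rewrite mulVKf // mulrCA mulVKf // -e.
Qed.

(** The zero vector is parallel to every vector but has its own class m + 2, whence the two
    exclusions. *)
Lemma parallel_cls c l c' l' :
  (lval c)^-1 * lval l' = (lval c')^-1 * lval l ->
  cls m (c, l) <> mm.+2 -> cls m (c', l') <> mm.+2 -> cls m (c, l) = cls m (c', l').
Proof.
have ltm k : (k %% mm < mm)%N by rewrite ltn_mod.
have th_mod k : th ^+ (k %% mm) = th ^+ k by rewrite expr_mod.
have nz k : th ^+ k != 0 by rewrite expf_neq0 ?th_neq0.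
have nzM i j : th ^- i * th ^+ j != 0 by rewrite mulf_neq0 ?invr_eq0.
case: c l c' l' => [|dc i] [|dl j] [|dc' i'] [|dl' j'] //=;
  rewrite ?invr0 ?(mul0r, mulr0) //.
all: try by move/eqP; rewrite ?[0 == _]eq_sym (negPf (nzM _ _)).
move=> e _ _; apply: th_inj; rewrite ?ltn_mod // !th_mod !exprD.
move/(congr1 (fun x => th ^+ N.to_nat i * (th ^+ N.to_nat i' * x))): e.
by rewrite mulrCA mulVKf // mulVKf // => ->.
Qed.
End Geometry.

(** * Tables, and field arithmetic on logarithms *)

Fixpoint zipcons T (s : seq T) (ss : seq (seq T)) : seq (seq T) :=
  match s, ss with
  | x :: s, xs :: ss => (x :: xs) :: zipcons s ss
  | _, _ => [::]
  end.

Definition transpose T n (ss : seq (seq T)) := foldr (@zipcons T) (nseq n [::]) ss.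

(** The head of [spl] belongs to 0 and entry j of its body to theta^j. For x = theta^i the rotation
    puts the entry of theta^(j - i) at position j, which amounts to dividing the argument by x. For
    x = 0 there is no division. *)
Definition line T (idl spl : seq T) (x : N) : seq T :=
  if x is N0 then idl else
  if spl is s0 :: body then s0 :: rot (size body - N.to_nat (N.pred x)) body else [::].

(** Fast random access to the table; keys are shifted by one because they are of type [positive]. *)
Fixpoint to_map (i : N) (s : seq N) (mp : PositiveMap.t N) :=
  if s is x :: s then to_map (N.succ i) s (PositiveMap.add (N.succ_pos i) x mp) else mp.

Section FieldOps.
Variables (m : N) (mp : PositiveMap.t N) (m1 D t e : N) (order : nat).
Definition fpred x := if PositiveMap.find (N.succ_pos x) mp is Some y then y else N0.
Definition modm x := if N.ltb x m then x else N.sub x m.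
Definition fmul x y :=
  match x, y with
  | N0, _ => N0
  | _, N0 => N0
  | _, _ => N.succ (modm (N.add (N.pred x) (N.pred y)))
  end.
Definition finv x := if x is N0 then N0 else N.succ (modm (N.sub m (N.pred x))).
(** x - y = y (x / y - 1), so that a table for subtracting 1 suffices. *)
Definition fsub x y := if y is N0 then x else fmul y (fpred (fmul x (finv y))).
(* The action on the pencil of lines y = u x; [N.succ m] stands for x = 0. *)
Definition mob u :=
  if N.eqb u (N.succ m) then fmul (fmul m1 t) (finv D)
  else if u is N0 then N.succ m else fmul (fsub m1 (fmul t u)) (finv (fmul D u)).
(** The image (-D a : 1 + t a : e b) of (1 : a : b), divided by its first coordinate. It is
    meaningful for nonzero a. *)
Definition act (ab : N * N) : N * N :=
  let den := finv (fmul D ab.1) in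
  (fmul (fsub m1 (fmul t ab.1)) den, fmul m1 (fmul (fmul e ab.2) den)).
Fixpoint mark (n : nat) (u : N) (V : PositiveMap.t unit) :=
  if n is n'.+1 then mark n' (mob u) (PositiveMap.add (N.succ_pos u) tt V) else V.
End FieldOps.

Lemma size_zipcons T n (s : seq T) ss : size s = n -> size ss = n -> size (zipcons s ss) = n.
Proof. by elim: n s ss => [|n IH] [|x s] [|y ss] //= [ss1] [ss2]; rewrite IH. Qed.

Lemma size_transpose T n (ss : seq (seq T)) :
  (forall s, List.In s ss -> size s = n) -> size (transpose n ss) = n.
Proof.
elim: ss => [|s ss IH] szs /=; first by rewrite size_nseq.
rewrite (@size_zipcons _ n) //; first by apply: szs; left.
by apply: IH => s' s'ss; apply: szs; right.
Qed.

Lemma nth_transpose T n d (ss : seq (seq T)) w :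
  (forall s, List.In s ss -> size s = n) -> w < n ->
  nth [::] (transpose n ss) w = [seq nth d s w | s <- ss].
Proof.
move=> szs lt_w; elim: ss szs => [|s ss IH] szs /=; first by rewrite nth_nseq lt_w.
rewrite -IH => [|s' s'ss]; last by apply: szs; right.
have : size (transpose n ss) = n by apply: size_transpose => s' s'ss; apply: szs; right.
have : size s = n by apply: szs; left.
move: (transpose n ss) => ts; elim: n s ts w lt_w {szs IH} => // n IHn [|x s] [|y ts] // [|w] //=.
by move=> lt_w [sz1] [sz2]; apply: IHn.
Qed.

Lemma map_line T U (f : T -> U) idl spl x : map f (line idl spl x) = line (map f idl) (map f spl) x.
Proof. by case: x spl => [|x] [|s0 body] //=; rewrite map_rot size_map. Qed.

Lemma find_to_map i s mp x :
  PositiveMap.find (N.succ_pos x) (to_map i s mp) =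
  if (N.to_nat i <= N.to_nat x) && (N.to_nat x < N.to_nat i + size s) then Some (nth N0 s (N.to_nat x - N.to_nat i))
  else PositiveMap.find (N.succ_pos x) mp.
Proof.
elim: s i mp => [|y s IH] i mp /=; first by case: ifP => //; lia.
rewrite IH; have [->|ne_x] := N.eq_dec x i.
  rewrite subnn PositiveMap.gss; case: ifP; first by lia.
  by case: ifP => //; lia.
rewrite PositiveMap.gso; last by lia.
have -> : N.to_nat (N.succ i) = (N.to_nat i).+1 by lia.
case: ifP => h1; case: ifP => h2 //; try by lia.
by have -> : N.to_nat x - N.to_nat i = (N.to_nat x - (N.to_nat i).+1).+1 by lia.
Qed.

(** * Correctness of the arithmetic on codes *)

Section FieldModel.
Local Open Scope ring_scope.
Variables (F : finFieldType) (th : F) (m : N) (sp : seq N).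
Let mm := N.to_nat m.
Definition fval (x : N) : F := if x is Npos _ then th ^+ N.to_nat (N.pred x) else 0.
Definition isf (x : N) := (N.to_nat x < mm.+1)%N.

Lemma lval_dlog nd x : lval th (dlog_of nd x) = fval x.
Proof. by case: x. Qed.

Lemma wf_dlog_of nd x : isf x -> wf_dlog nd m (dlog_of nd x).
Proof. by rewrite /isf; case: x => //= p fx; split=> //; rewrite -/mm; lia. Qed.

Hypothesis m_gt0 : (0 < mm)%N.
Hypothesis th_m : th ^+ mm = 1.

Let th0 := th_neq0 m_gt0 th_m.

Lemma fval_succ i : fval (N.succ i) = th ^+ N.to_nat i.
Proof. by rewrite /fval; case: (N.succ i) (N.neq_succ_0 i) (N.pred_succ i) => // p _ ->. Qed.

Lemma fval_eq0 x : (fval x == 0) = (x == N0 :> N).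
Proof. by case: x => [|p] /=; [rewrite !eqxx | rewrite expf_eq0 (negPf th0) andbF]. Qed.

Lemma modmP i : (N.to_nat i < 2 * mm)%N ->
  (N.to_nat (modm m i) < mm)%N /\ th ^+ N.to_nat (modm m i) = th ^+ N.to_nat i.
Proof.
rewrite /modm => lti; case: N.ltb_spec => lt_m; first by split=> //; rewrite /mm; lia.
split; first by move: lti; rewrite /mm; lia.
have -> : N.to_nat i = (mm + N.to_nat (N.sub i m))%N by rewrite /mm; lia.
by rewrite exprD th_m mul1r.
Qed.

Lemma isf_succ i : isf (N.succ i) = (N.to_nat i < mm)%N.
Proof. by rewrite /isf; lia. Qed.

Lemma fmulP x y : isf x -> isf y -> isf (fmul m x y) /\ fval (fmul m x y) = fval x * fval y.
Proof.
rewrite /isf; case: x y => [|x] [|y] fx fy /=; rewrite ?(mul0r, mulr0) //.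
have [lt_s e] := @modmP (N.add (N.pred (Npos x)) (N.pred (Npos y))) ltac:(lia).
rewrite -/(isf _) isf_succ fval_succ e; split=> //.
by rewrite -exprD; congr (_ ^+ _); lia.
Qed.

Lemma finvP x : isf x -> isf (finv m x) /\ fval (finv m x) = (fval x)^-1.
Proof.
rewrite /isf; case: x => [|x] fx; first by rewrite /= invr0.
have [lt_s e] := @modmP (N.sub m (N.pred (Npos x))) ltac:(rewrite /mm; lia).
rewrite -/(isf _) isf_succ fval_succ e; split=> //.
apply: (mulIf (x := fval (Npos x))); first by rewrite fval_eq0.
rewrite mulVf ?fval_eq0 // -exprD -th_m; congr (_ ^+ _); move: fx; rewrite /mm; lia.
Qed.

Hypothesis size_sp : size sp = mm.+1.
Hypothesis spP : forall x, isf x -> isf (nth N0 sp (N.to_nat x))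
  /\ fval (nth N0 sp (N.to_nat x)) = fval x - 1.

Lemma fpredP x : isf x ->
  isf (fpred (to_map N0 sp (PositiveMap.empty N)) x)
  /\ fval (fpred (to_map N0 sp (PositiveMap.empty N)) x) = fval x - 1.
Proof.
move=> fx; rewrite /fpred find_to_map size_sp leq0n subn0 /=.
by rewrite (_ : (N.to_nat x < 0 + mm.+1)%N) //; apply: spP.
Qed.

Lemma fsubP x y : let z := fsub m (to_map N0 sp (PositiveMap.empty N)) x y in
  isf x -> isf y -> isf z /\ fval z = fval x - fval y.
Proof.
rewrite /fsub; case: y => [|y] fx fy; first by rewrite subr0.
have [fi ei] := finvP fy; have [fm em] := fmulP fx fi.
have [fp ep] := fpredP fm; have [fr er] := fmulP fy fp; split=> //.
by rewrite er ep em ei mulrBr mulr1 mulrCA mulfV ?mulr1 // fval_eq0.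
Qed.

Definition codes := [seq N.of_nat i | i <- iota 0 mm.+1].

(** This is u - a up to a nonzero factor depending on a only, so parallelism of offset vectors at a
    fixed point is parallelism of true differences. *)
Definition offset (u a : F) : F := if a == 0 then u else u / a - 1.

Lemma nth_line w x : isf w -> isf x ->
  let y := nth N0 (line codes sp x) (N.to_nat w) in
  isf y /\ fval y = offset (fval w) (fval x).
Proof.
rewrite /offset fval_eq0; case: x => [|x] fw fx.
  by rewrite /= (nth_map 0%N) ?size_iota // nth_iota // add0n N2Nat.id.
have := spP; move: size_sp; rewrite /line; case: sp => // s0 body [sz] spP'.
have lt_i : (N.to_nat (N.pred (Npos x)) < mm)%N by move: fx; rewrite /isf; lia.
rewrite [_ == _]/= [fval (Npos x)]/=; move: (N.to_nat (N.pred _)) lt_i => i lt_i.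
have nz : th ^+ i != 0 by rewrite expf_neq0.
case: w fw => [|w] fw.
  by have /= [? ->] := spP' N0 isT; rewrite /= mul0r.
have -> : N.to_nat (Npos w) = (N.to_nat (N.pred (Npos w))).+1 by lia.
have lt_j : (N.to_nat (N.pred (Npos w)) < mm)%N by move: fw; rewrite /isf; lia.
rewrite [fval (Npos w)]/=; move: (N.to_nat (N.pred _)) lt_j => j lt_j /=.
have bodyP k : (k < mm)%N -> isf (nth N0 body k) /\ fval (nth N0 body k) = th ^+ k - 1.
  move=> lt_k; have := spP' (N.succ (N.of_nat k)).
  rewrite isf_succ fval_succ !Nat2N.id; have -> : N.to_nat (N.succ (N.of_nat k)) = k.+1 by lia.
  by apply.
rewrite sz /rot nth_cat size_drop sz subKn ?(ltnW lt_i) // nth_drop.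
(* For j < i the rotated list supplies the entry of theta^(m - i + j), which is theta^(j - i)
   because theta^m = 1. *)
case: ltnP => le_ij.
  have [ff ->] := bodyP (mm - i + j)%N ltac:(lia); split=> //; congr (_ - 1).
  apply: (mulIf nz); rewrite divfK // -exprD.
  have -> : (mm - i + j + i = mm + j)%N by lia.
  by rewrite exprD th_m mul1r.
rewrite nth_take; last by lia.
have [ff ->] := bodyP (j - i)%N ltac:(lia); split=> //; congr (_ - 1).
by apply: (mulIf nz); rewrite divfK // -exprD subnK.
Qed.

Lemma size_line T (f : N -> T) x : size (line (map f codes) (map f sp) x) = mm.+1.
Proof.
case: x => [|x]; first by rewrite !size_map size_iota.
by rewrite /line; case: sp size_sp => //= s0 body; rewrite size_rot size_map.
Qed.

End FieldModel.

(** * The tables of an arc and what they prove *)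

(** The set of marked lines is returned because it may contain x = 0, which is not among the
    columns. *)
Fixpoint sweep m mp m1 D t order (ts : seq dirs) (rows : seq (seq dlog))
    (u : N) (cols : seq (seq dlog)) (V : PositiveMap.t unit) : option (PositiveMap.t unit) :=
  if cols is cs :: cols then
    if PositiveMap.find (N.succ_pos u) V is Some _ then
      sweep m mp m1 D t order ts rows (N.succ u) cols V
    else if column_ok ts cs rows then
      sweep m mp m1 D t order ts rows (N.succ u) cols (mark m mp m1 D t order u V)
    else None
  else Some V.

Definition row_table nd q sp (K : seq (N * N)) : seq (seq dlog) :=
  let Lid := [seq dlog_of nd x | x <- [seq N.of_nat i | i <- iota 0 q]] in
  let Lsp := [seq dlog_of nd x | x <- sp] in
  transpose q [seq line Lid Lsp ab.2 | ab <- K].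

(** Inverses are stored so that a slope is a product and its logarithm a sum. *)
Definition col_table nd m q sp (K : seq (N * N)) : seq (seq dlog) :=
  let Lid := [seq dlog_of nd (finv m x) | x <- [seq N.of_nat i | i <- iota 0 q]] in
  let Lsp := [seq dlog_of nd (finv m x) | x <- sp] in
  transpose q [seq line Lid Lsp ab.1 | ab <- K].

(** Every arc point is added to every record, including its own, where it sets the last flag. *)
Definition dir_table nd m (cols rows : seq (seq dlog)) (K : seq (N * N)) : seq dirs :=
  foldl (fun ts ab => add_dirs nd m ts (nth [::] cols (N.to_nat ab.1)) (nth [::] rows (N.to_nat ab.2)))
    (nseq (size K) (Dirs (Lf false) false false false)) K.

Definition not_bad t := if t is Bad then false else true.

(** The determinant with rows (x, y, z), (1, A), (1, B): it vanishes when (x : y : z) lies on the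
    line AB. *)
Definition det3 (F : fieldType) (x y z : F) (A B : F * F) : F :=
  (x * (A.1 * B.2 - B.1 * A.2) - y * (B.2 - A.2) + z * (B.1 - A.1))%R.

Section Tables.
Local Open Scope ring_scope.
Variables (F : finFieldType) (th : F) (nd : nat) (m : N) (sp : seq N).
Let mm := N.to_nat m.
Let q := mm.+1.
Hypothesis m_gt0 : (0 < mm)%N.
Hypothesis le_nd : (2 * mm <= 4 ^ nd)%N.
Hypothesis th_m : th ^+ mm = 1.
Hypothesis th_inj : forall i j, (i < mm)%N -> (j < mm)%N -> th ^+ i = th ^+ j -> i = j.
Hypothesis size_sp : size sp = mm.+1.
Hypothesis spP : forall x, isf m x -> isf m (nth N0 sp (N.to_nat x))
  /\ fval th (nth N0 sp (N.to_nat x)) = fval th x - 1.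
Variable K : seq (N * N).
Hypothesis K_isf : {in K, forall ab, isf m ab.1 /\ isf m ab.2}.

Local Notation val := (fval th).
Definition pt (ab : N * N) : F * F := (val ab.1, val ab.2).
Definition covers (x y z : F) : Prop :=
  exists A B, [/\ A \in map pt K, B \in map pt K, A != B & det3 x y z A B = 0].

Let rows := row_table nd q sp K.
Let cols := col_table nd m q sp K.
Let ts := dir_table nd m cols rows K.
Hypothesis ts_ok : all not_bad ts.

Let Lent (w : N) (ab : N * N) := dlog_of nd (nth N0 (line (codes m) sp ab.2) (N.to_nat w)).
Let Cent (u : N) (ab : N * N) := dlog_of nd (finv m (nth N0 (line (codes m) sp ab.1) (N.to_nat u))).

Lemma nth_rows w : isf m w -> nth [::] rows (N.to_nat w) = map (Lent w) K.
Proof.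
move=> fw; rewrite /rows /row_table (@nth_transpose _ _ Z) // => [|s /List.in_map_iff[ab [<- _]]].
  rewrite -map_comp; apply: eq_map => ab.
  change (nth Z (line (map (dlog_of nd) (codes m)) (map (dlog_of nd) sp) ab.2) (N.to_nat w) = Lent w ab).
  rewrite -map_line (nth_map N0) //.
  by have := size_line size_sp id ab.2; rewrite !map_id => ->.
exact: size_line.
Qed.

Lemma nth_cols u : isf m u -> nth [::] cols (N.to_nat u) = map (Cent u) K.
Proof.
move=> fu; rewrite /cols /col_table (@nth_transpose _ _ Z) // => [|s /List.in_map_iff[ab [<- _]]].
  rewrite -map_comp; apply: eq_map => ab.
  pose f x := dlog_of nd (finv m x).
  change (nth Z (line (map f (codes m)) (map f sp) ab.1) (N.to_nat u) = Cent u ab).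
  rewrite -map_line (nth_map N0) //.
  by have := size_line size_sp id ab.1; rewrite !map_id => ->.
exact: (size_line size_sp (fun x => dlog_of nd (finv m x))).
Qed.

Lemma CentP u ab : isf m u -> isf m ab.1 ->
  (lval th (Cent u ab))^-1 = offset (val u) (val ab.1) /\ wf_dlog nd m (Cent u ab).
Proof.
move=> fu fa; have [fy ey] := nth_line m_gt0 th_m size_sp spP fu fa.
have [fi ei] := finvP m_gt0 th_m fy.
by rewrite lval_dlog ei ey invrK; split=> //; apply: wf_dlog_of.
Qed.

Lemma LentP w ab : isf m w -> isf m ab.2 ->
  lval th (Lent w ab) = offset (val w) (val ab.2) /\ wf_dlog nd m (Lent w ab).
Proof.
move=> fw fa; have [fy ey] := nth_line m_gt0 th_m size_sp spP fw fa.
by rewrite lval_dlog ey; split=> //; apply: wf_dlog_of.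
Qed.

Lemma offset_scale (a : F) : {c | c != 0 & forall u, offset u a = c * (u - a)}.
Proof.
rewrite /offset; have [->|nz] := eqVneq a 0; first by exists 1; rewrite ?oner_neq0 // => u; rewrite subr0 mul1r.
by exists a^-1; rewrite ?invr_eq0 // => u; rewrite mulrBr mulVf // mulrC.
Qed.

Lemma offset_parallel (a b u w u' w' : F) :
  (offset u a * offset w' b == offset u' a * offset w b) =
  ((u - a) * (w' - b) == (u' - a) * (w - b)).
Proof.
have [c nc cE] := offset_scale a; have [d nd0 dE] := offset_scale b.
rewrite !cE !dE (mulrACA c (u - a)) (mulrACA c (u' - a)).
by rewrite (inj_eq (mulfI (mulf_neq0 nc nd0))).
Qed.

Lemma offset_eq0 (u a : F) : (offset u a == 0) = (u == a).
Proof. by have [c nc ->] := offset_scale a; rewrite mulf_eq0 (negPf nc) subr_eq0. Qed.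

Lemma cls_self (c l : dlog) : cls m (c, l) = mm.+2 <-> lval th c = 0 /\ lval th l = 0.
Proof.
have nz (k : N) : th ^+ N.to_nat k = 0 -> False.
  by move/eqP; rewrite expf_eq0 (negPf (th_neq0 m_gt0 th_m)) andbF.
case: c l => [|dc i] [|dl j]; split=> //=; try by [case=> // _ /nz | case=> /nz | rewrite -/mm; lia].
Qed.

Let clsP (P : N * N) (ab : N * N) := cls m (Cent P.1 ab, Lent P.2 ab).
Let isF (P : N * N) := isf m P.1 /\ isf m P.2.

Lemma clsP_self P ab : isF P -> isF ab -> clsP P ab = mm.+2 <-> pt P = pt ab.
Proof.
case=> fu fw [fa fb]; rewrite /clsP cls_self.
have [ec _] := CentP fu fa; have [el _] := LentP fw fb; rewrite el.
have -> : lval th (Cent P.1 ab) = 0 <-> val P.1 = val ab.1.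
  split=> [e0|e]; first by apply/eqP; rewrite -offset_eq0 -ec e0 invr0.
  by apply/eqP; rewrite -invr_eq0 ec offset_eq0 e.
have -> : offset (val P.2) (val ab.2) = 0 <-> val P.2 = val ab.2.
  by split=> e; apply/eqP; [rewrite -offset_eq0 e | rewrite offset_eq0 e].
by rewrite /pt; split=> [[-> ->]|[]].
Qed.

(** The conclusion is the collinearity of P, Q and [ab]. *)
Lemma clsP_par P Q ab : isF P -> isF Q -> isF ab -> clsP P ab = clsP Q ab ->
  (val P.1 - val ab.1) * (val Q.2 - val ab.2) = (val Q.1 - val ab.1) * (val P.2 - val ab.2).
Proof.
case=> f1 f2 [f3 f4] [f5 f6] /(cls_parallel m_gt0 th_m).
have [-> _] := CentP f1 f5; have [-> _] := CentP f3 f5.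
have [-> _] := LentP f2 f6; have [-> _] := LentP f4 f6.
by move/eqP; rewrite offset_parallel => /eqP.
Qed.

Lemma par_clsP P Q ab : isF P -> isF Q -> isF ab ->
  (val P.1 - val ab.1) * (val Q.2 - val ab.2) = (val Q.1 - val ab.1) * (val P.2 - val ab.2) ->
  pt P <> pt ab -> pt Q <> pt ab -> clsP P ab = clsP Q ab.
Proof.
move=> fP fQ fab /eqP; rewrite -offset_parallel => /eqP e nP nQ.
apply: (parallel_cls m_gt0 th_m th_inj); last 2 first.
- by move=> /(clsP_self fP fab).
- by move=> /(clsP_self fQ fab).
case: fP fQ fab => f1 f2 [f3 f4] [f5 f6].
have [-> _] := CentP f1 f5; have [-> _] := CentP f3 f5.
by have [-> _] := LentP f2 f6; have [-> _] := LentP f4 f6.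
Qed.

Lemma size_ts : size ts = size K.
Proof.
rewrite /ts /dir_table (@size_fold_add_dirs nd m) ?size_nseq // => ab abK.
have [fa fb] := K_isf abK.
by rewrite nth_rows // nth_cols // !size_map.
Qed.

(** The list of classes is indexed like [K], so that its being duplicate-free separates arc points
    by their indices. *)
Lemma tsP i : (i < size K)%N -> dirs_inv nd m (nth Bad ts i) [seq clsP ab (nth (N0, N0) K i) | ab <- K].
Proof.
move=> lti.
have szK : {in K, forall ab, size (nth [::] cols (N.to_nat ab.1)) = size (nseq (size K) (Dirs (Lf false) false false false))
    /\ size (nth [::] rows (N.to_nat ab.2)) = size (nseq (size K) (Dirs (Lf false) false false false))}.
  by move=> ab abK; have [fa fb] := K_isf abK; rewrite nth_rows // nth_cols // !size_map size_nseq.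
have nb : nth Bad ts i <> Bad.
  by move=> eB; have /(all_nthP Bad)/(_ i) := ts_ok; rewrite size_ts eB => /(_ lti).
have szi : (i < size (nseq (size K) (Dirs (Lf false) false false false)))%N by rewrite size_nseq.
move: nb; rewrite /ts /dir_table (nth_fold_add_dirs nd m szi szK) nth_nseq lti.
set A := nth (N0, N0) K i.
(* Table lookups are replaced by the entries they hold, which is legitimate only at codes of points
   of [K]. *)
have foldE K' t0 : {subset K' <= K} ->
    foldl (fun t x => add_dir nd m t (nth Z (nth [::] cols (N.to_nat x.1)) i)
                                     (nth Z (nth [::] rows (N.to_nat x.2)) i)) t0 K' =
    foldl (fun t x => add_dir nd m t (Cent x.1 A) (Lent x.2 A)) t0 K'.
  elim: K' t0 => //= x K' IH t0 sK; have [fa fb] := K_isf (sK x (mem_head _ _)).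
  rewrite nth_rows // nth_cols // !(nth_map (N0, N0)) //; apply: IH => y yK'.
  by apply: sK; rewrite inE yK' orbT.
rewrite foldE //.
move=> nb.
apply: (@fold_add_dirP nd m _ (fun x : N * N => Cent x.1 A) (fun x => Lent x.2 A)) => //.
move=> x xK; have [fa fb] := K_isf xK; have [fA fB] := K_isf (mem_nth (N0, N0) lti).
by split; [case: (CentP fa fA) | case: (LentP fb fB)].
Qed.

(** A repeated point would put the code m + 2 twice into its own record. *)
Lemma uniq_pts : uniq (map pt K).
Proof.
have [//|] := boolP (uniq (map pt K)); case/(uniqPn (pt (N0, N0))) => i [j [ltij ltj e]].
rewrite size_map in ltj; have lti := ltn_trans ltij ltj.
rewrite !(nth_map (N0, N0)) // in e.
have fi := K_isf (mem_nth (N0, N0) lti); have fj := K_isf (mem_nth (N0, N0) ltj).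
have := tsP lti; rewrite /dirs_inv; case: (nth Bad ts i) => // ? ? ? ? [_ _ _].
move/(uniqP 0%N) => /(_ i j); rewrite !inE !size_map !(nth_map (N0, N0)) // lti ltj.
have -> : clsP (nth (N0, N0) K i) (nth (N0, N0) K i) = mm.+2 by apply/clsP_self.
have -> : clsP (nth (N0, N0) K j) (nth (N0, N0) K i) = mm.+2 by apply/clsP_self.
by move=> /(_ isT isT erefl) eij; rewrite eij ltnn in ltij.
Qed.

(** If A, B, C were collinear, B and C would have the same class in the record of A. *)
Lemma arc_pts A B C : A \in map pt K -> B \in map pt K -> C \in map pt K ->
  A != B -> A != C -> B != C -> det3 1 A.1 A.2 B C != 0.
Proof.
case/mapP=> a aK ->{A} /mapP[b bK ->{B}] /mapP[c cK ->{C}] nab nac nbc.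
apply/eqP => d0.
have fa := K_isf aK; have fb := K_isf bK; have fc := K_isf cK.
have lti : (index a K < size K)%N by rewrite index_mem.
have := tsP lti; rewrite nth_index // /dirs_inv; case: (nth Bad ts _) => // ? ? ? ? [_ _ _].
move/(uniqP 0%N) => /(_ (index b K) (index c K)).
rewrite !inE !size_map !index_mem bK cK !(nth_map (N0, N0)) ?index_mem // !nth_index //.
rewrite (@par_clsP b c a) //; first last.
- by move/esym; apply/eqP.
- by move/esym; apply/eqP.
- apply/eqP; rewrite -subr_eq0 -[X in _ == X]d0; apply/eqP; rewrite /det3 /=; ring.
move=> /(_ isT isT erefl) ebc; move: nbc.
by rewrite -(nth_index (N0, N0) bK) ebc nth_index // eqxx.
Qed.

Hypothesis K_gt1 : (1 < size K)%N.

Lemma mem_covers A : A \in map pt K -> covers 1 A.1 A.2.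
Proof.
move=> AK; have uK := uniq_pts.
have [B BK nBA] : exists2 B, B \in map pt K & B != A.
  have : (0 < size (rem A (map pt K)))%N by rewrite size_rem // size_map; case: (size K) K_gt1 => [|[]].
  case e : (rem A _) => [|B s] // _; exists B; last first.
    by have := mem_rem_uniq A uK B; rewrite e mem_head inE => /esym/andP[].
  by apply: (@mem_rem _ A); rewrite e mem_head.
by exists A, B; split; rewrite 1?eq_sym // /det3; ring.
Qed.

Lemma covered_covers u w : isf m u -> isf m w ->
  covered ts (nth [::] cols (N.to_nat u)) (nth [::] rows (N.to_nat w)) -> covers 1 (val u) (val w).
Proof.
move=> fu fw; rewrite nth_rows // nth_cols //.
case/(coveredP m_gt0 le_nd (S := fun i => [seq clsP ab (nth (N0, N0) K i) | ab <- K])).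
- by rewrite size_map size_ts.
- by rewrite size_map size_ts.
- by move=> i; rewrite size_ts; apply: tsP.
- move=> i; rewrite size_ts => lti; rewrite !(nth_map (N0, N0)) //.
  have [fA fB] := K_isf (mem_nth (N0, N0) lti).
  by split; [case: (CentP fu fA) | case: (LentP fw fB)].
move=> i; rewrite size_ts => lti; rewrite !(nth_map (N0, N0)) //.
have abK := mem_nth (N0, N0) lti; move: (nth _ K i) abK => ab abK.
have fab := K_isf abK; rewrite -[cls m _]/(clsP (u, w) ab).
have fP : isF (u, w) by [].
case=> [/(clsP_self fP fab) [-> ->]|[le_m /mapP[c cK e]]].
  by apply: (@mem_covers (pt ab)); apply: map_f.
(* The class of [ab] seen from itself is m + 2, beyond the bound [le_m]; so [c] is a second point of
   the secant. *)
have fc := K_isf cK; have nc : pt c != pt ab.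
  by apply/eqP => /(clsP_self fc fab) ec; move: le_m; rewrite e ec /mm; lia.
exists (pt ab), (pt c); split; rewrite ?map_f // 1?eq_sym //.
have /eqP := clsP_par fP fc fab e.
rewrite -subr_eq0 => /eqP e0; apply: oppr_inj; rewrite oppr0 -e0 /det3 /=; ring.
Qed.

Hypothesis val_surj : forall y : F, exists2 x, isf m x & val x = y.

(** Either two arc points lie on y = u x and this line is a secant, or every point of the column was
    tested. *)
Lemma column_covers u : isf m u -> column_ok ts (nth [::] cols (N.to_nat u)) rows ->
  forall w, covers 1 (val u) w.
Proof.
move=> fu; rewrite /column_ok; case: ifP => [two _ w|_ ok w].
  move: two; rewrite nth_cols // count_map => two.
  have uK := map_uniq uniq_pts.
  have : (1 < size (filter (preim (Cent u) isZ) K))%N by rewrite size_filter.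
  case e : (filter _ K) => [|a [|b s]] // _.
  have us : uniq [:: a, b & s] by rewrite -e filter_uniq.
  have ina : a \in filter (preim (Cent u) isZ) K by rewrite e mem_head.
  have inb : b \in filter (preim (Cent u) isZ) K by rewrite e !inE eqxx orbT.
  have onu c : c \in filter (preim (Cent u) isZ) K -> c \in K /\ val c.1 = val u.
    rewrite mem_filter /= => /andP[cz cK]; split=> //; have [fc _] := K_isf cK.
    have [ec _] := CentP fu fc; move: ec cz; case: (Cent u c) => //= + _.
    by rewrite invr0 => /esym/eqP; rewrite offset_eq0 => /eqP.
  have [aK ea] := onu a ina; have [bK eb] := onu b inb.
  exists (pt a), (pt b); rewrite !map_f //; split=> //; last by rewrite /det3 /= ea eb; ring.
  move: us; rewrite /= inE negb_or -andbA => /andP[nab _]; apply: contraNneq nab => eab.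
  apply/eqP; have := mem_nth; move/(uniqP (pt (N0, N0))): uniq_pts => inj.
  move=> _; rewrite -(nth_index (N0, N0) aK) -(nth_index (N0, N0) bK); congr (nth _ _ _).
  by apply: inj; rewrite ?inE ?size_map ?index_mem // !(nth_map (N0, N0)) ?index_mem // !nth_index.
have [x fx <-] := val_surj w.
apply: covered_covers => //.
have lx : (N.to_nat x < size rows)%N.
  rewrite /rows /row_table size_transpose // => s /List.in_map_iff[ab [<- _]].
  exact: size_line.
move: ok lx; move: (nth _ cols _) => cs; elim: rows (N.to_nat x) => [|ls rs IH] [|k] //=.
  by case: ifP.
by case: ifP => // _ ok; rewrite ltnS; apply: IH.
Qed.
End Tables.

(** * The test of one arc *)

(** A vertical direction at an arc point means a secant through (0 : 0 : 1), which is thereby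
    covered. *)
Definition vertical t := if t is Dirs _ _ v _ then v else false.

(** The point (0 : 1 : w) lies on the secants of slope w; the slope equation is multiplied out to
    avoid a division. *)
Definition infinity_ok m mp q (K : seq (N * N)) : bool :=
  all (fun w => has (fun ab => has (fun cd =>
    (ab != cd) && (fsub m mp ab.2 cd.2 == fmul m w (fsub m mp ab.1 cd.1))) K) K)
    [seq N.of_nat i | i <- iota 0 q].

(* Each representative in [reps] comes with the length of its orbit. *)
Definition points m mp m1 D t e (reps : seq (N * (N * N))) : seq (N * N) :=
  flatten [seq traject (act m mp m1 D t e) r.2 (N.to_nat r.1) | r <- reps].

(** For [order] 1 no symmetry is claimed. Otherwise each orbit must close up and avoid the line y =
    0, which the group generator sends to x = 0, where there are no affine points. *)
Definition points_ok m mp m1 D t e order (reps : seq (N * (N * N))) : bool :=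
  all (fun r => N.ltb r.2.1 (N.succ m) && N.ltb r.2.2 (N.succ m)) reps &&
  ((order == 1) ||
   all (fun r => (iter (N.to_nat r.1) (act m mp m1 D t e) r.2 == r.2)
     && all (fun ab => ab.1 != N0) (traject (act m mp m1 D t e) r.2 (N.to_nat r.1))) reps).

(** [m1], the first entry of the table of predecessors, is the code of -1. The last test concerns
    the line x = 0: either it lies in the orbit of a covered line, or its points are tested one by
    one. *)
Definition arc_ok nd m sp D t e order reps : bool :=
  let q := (N.to_nat m).+1 in
  let mp := to_map N0 sp (PositiveMap.empty N) in
  let m1 := head N0 sp in
  let K := points m mp m1 D t e reps in
  let rows := row_table nd q sp K in
  let cols := col_table nd m q sp K in
  let ts := dir_table nd m cols rows K in
  [&& N.ltb D (N.succ m), N.ltb t (N.succ m), N.ltb e (N.succ m), D != N0, e != N0,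
      points_ok m mp m1 D t e order reps, 1 < size K, all not_bad ts, has vertical ts &
      if sweep m mp m1 D t order ts rows N0 cols (PositiveMap.empty unit) is Some V then
        if PositiveMap.find (N.succ_pos (N.succ m)) V is Some _ then true
        else infinity_ok m mp q K
      else false].

Lemma mem_traject_closed (T : eqType) (f : T -> T) x n y :
  iter n f x = x -> y \in traject f x n -> f y \in traject f x n.
Proof.
move=> fx /trajectP[i lti ->]; rewrite -iterS.
have [ltn|] := ltnP i.+1 n; first by apply/trajectP; exists i.+1.
move=> le_n; have -> : i.+1 = n by lia.
by rewrite fx; apply/trajectP; exists 0 => //; apply: leq_ltn_trans lti.
Qed.

(** * Completeness from one line per orbit *)

Section Complete.
Local Open Scope ring_scope.
Variables (F : finFieldType) (th : F) (nd : nat) (m : N) (sp : seq N).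
Let mm := N.to_nat m.
Let q := mm.+1.
Hypothesis m_gt0 : (0 < mm)%N.
Hypothesis le_nd : (2 * mm <= 4 ^ nd)%N.
Hypothesis th_m : th ^+ mm = 1.
Hypothesis th_inj : forall i j, (i < mm)%N -> (j < mm)%N -> th ^+ i = th ^+ j -> i = j.
Hypothesis size_sp : size sp = mm.+1.
Hypothesis spP : forall x, isf m x -> isf m (nth N0 sp (N.to_nat x))
  /\ fval th (nth N0 sp (N.to_nat x)) = fval th x - 1.
Hypothesis val_surj : forall y : F, exists2 x, isf m x & fval th x = y.

Local Notation val := (fval th).
Let mp := to_map N0 sp (PositiveMap.empty N).
Let m1 := head N0 sp.

Variables (D t e : N) (order : nat) (reps : seq (N * (N * N))).
Let K := points m mp m1 D t e reps.
Local Notation mob := (mob m mp m1 D t).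
Local Notation act := (act m mp m1 D t e).
Local Notation covers := (covers th K).

Lemma m1P : isf m m1 /\ val m1 = -1.
Proof. by have := spP (x := N0) isT; rewrite /m1 -nth0 sub0r. Qed.

Hypotheses (fD : isf m D) (ft : isf m t) (fe : isf m e) (nzD : D != N0) (nze : e != N0).

Let nzvD : val D != 0. Proof. by rewrite (fval_eq0 m_gt0 th_m). Qed.
Let nzve : val e != 0. Proof. by rewrite (fval_eq0 m_gt0 th_m). Qed.

Lemma actP ab : isf m ab.1 -> isf m ab.2 ->
  [/\ isf m (act ab).1, isf m (act ab).2 &
   pt th (act ab) = ((-1 - val t * val ab.1) / (val D * val ab.1),
                     - (val e * val ab.2 / (val D * val ab.1)))].
Proof.
move=> fa fb; have [fm em] := m1P.
have [f1 e1] := fmulP m_gt0 th_m fD fa.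
have [f2 e2] := finvP m_gt0 th_m f1.
have [f3 e3] := fmulP m_gt0 th_m ft fa.
have [f4 e4] := fsubP m_gt0 th_m size_sp spP fm f3.
have [f5 e5] := fmulP m_gt0 th_m f4 f2.
have [f6 e6] := fmulP m_gt0 th_m fe fb.
have [f7 e7] := fmulP m_gt0 th_m f6 f2.
have [f8 e8] := fmulP m_gt0 th_m fm f7.
by split=> //; rewrite /pt /act e5 e8 e4 e2 e1 e3 e7 e6 e2 e1 em mulN1r.
Qed.

Lemma mobP u : isf m u -> u != N0 -> isf m (mob u) /\
  val (mob u) = (-1 - val t * val u) / (val D * val u).
Proof.
move=> fu nz; have [fm em] := m1P.
have [f1 e1] := fmulP m_gt0 th_m fD fu.
have [f2 e2] := finvP m_gt0 th_m f1.
have [f3 e3] := fmulP m_gt0 th_m ft fu.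
have [f4 e4] := fsubP m_gt0 th_m size_sp spP fm f3.
have [f5 e5] := fmulP m_gt0 th_m f4 f2.
have -> : mob u = fmul m (fsub m mp m1 (fmul m t u)) (finv m (fmul m D u)).
  rewrite /mob; case: N.eqb_spec => [eu|_]; first by move: fu; rewrite eu /isf; clear; lia.
  by case: (u) nz.
by rewrite e5 e4 e2 e1 e3 em.
Qed.

Lemma mob_infinity : isf m (mob (N.succ m)) /\ val (mob (N.succ m)) = - (val t / val D).
Proof.
have [fm em] := m1P.
have [f1 e1] := fmulP m_gt0 th_m fm ft.
have [f2 e2] := finvP m_gt0 th_m fD.
have [f3 e3] := fmulP m_gt0 th_m f1 f2.
by rewrite /mob N.eqb_refl e3 e1 e2 em mulN1r mulNr.
Qed.

Lemma mob0 : mob N0 = N.succ m.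
Proof. by rewrite /mob; case: N.eqb_spec => //; lia. Qed.

(** The common point (0 : 0 : 1) of these lines is left out; [verticalP] treats it. *)
Definition column_covered (u : N) : Prop :=
  if u == N.succ m then forall w, covers 0 1 w else forall w, covers 1 (val u) w.

Lemma coversZ c x y z : c != 0 -> covers (c * x) (c * y) (c * z) -> covers x y z.
Proof.
move=> nz [A [B [AK BK nAB d0]]]; exists A, B; split=> //.
by apply: (mulfI nz); rewrite mulr0 -d0 /det3; ring.
Qed.

Hypothesis reps_isf : {in reps, forall r, isf m r.2.1 /\ isf m r.2.2}.

Lemma K_isf : {in K, forall ab, isf m ab.1 /\ isf m ab.2}.
Proof.
move=> ab /flattenP[s /mapP[r rreps ->{s}] /trajectP[i _ ->]].
elim: i => [|i [f1 f2]]; first exact: reps_isf.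
by rewrite iterS; case: (actP f1 f2).
Qed.

Section Invariant.
Hypothesis K_act : {in K, forall ab, act ab \in K /\ ab.1 != N0}.

(** A projectivity preserving the arc sends secants to secants. *)
Lemma covers_act x y z : covers x y z -> covers (- val D * y) (x + val t * y) (val e * z).
Proof.
case=> A [B [/mapP[a aK ->] /mapP[b bK ->] nab d0]].
have [a'K nza] := K_act aK; have [b'K nzb] := K_act bK.
have [fa fa'] := K_isf aK; have [fb fb'] := K_isf bK.
have [_ _ ea] := actP fa fa'; have [_ _ eb] := actP fb fb'.
have nva : val a.1 != 0 by rewrite (fval_eq0 m_gt0 th_m).
have nvb : val b.1 != 0 by rewrite (fval_eq0 m_gt0 th_m).
exists (pt th (act a)), (pt th (act b)); split; rewrite ?map_f //.
  (* The action is injective: the first coordinate of the image determines a, and then the second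
     determines b. *)
  apply: contra nab; rewrite ea eb /pt xpair_eqE => /andP[/eqP e1 /eqP e2].
  have e12 : val a.1 = val b.1.
    move/eqP: e1; rewrite eqr_div ?mulf_neq0 // -subr_eq0 => /eqP h1.
    apply: (mulfI nzvD); apply/eqP; rewrite -subr_eq0 -h1; apply/eqP; ring.
  apply/eqP; congr (_, _) => //; move: e2; rewrite -e12 => /oppr_inj.
  by move/(mulIf (invr_neq0 (mulf_neq0 nzvD nva)))/(mulfI nzve).
(* The matrix of the map has determinant D e, and the two images were divided by -D a and -D b for
   the first coordinates a, b; the product of these divisors is the factor here. *)
have h : val D ^+ 2 * (val a.1 * val b.1) != 0 by rewrite !mulf_neq0 ?expf_neq0.
apply: (mulfI h); rewrite mulr0 -[RHS](mulr0 (val D * val e)) -d0 ea eb /det3 /pt /=.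
by field; rewrite nva nvb nzvD.
Qed.

(** Each point of the image line is the image of a point of the covered line. The three cases are u
    infinite, u = 0 (sent to infinity) and the generic u. The argument given to [cov] is the
    preimage of w. *)
Lemma column_covered_mob u : (N.to_nat u <= q)%N -> column_covered u ->
  (N.to_nat (mob u) <= q)%N /\ column_covered (mob u).
Proof.
rewrite /column_covered; case: eqP => [-> _ cov|ne_u le_u cov].
  have [fv ev] := mob_infinity; split; first exact: ltnW.
  case: eqP => [ei|_ w]; first by move: fv; rewrite ei /isf; clear; lia.
  apply: (coversZ (c := - val D)); first by rewrite oppr_eq0.
  have := covers_act (cov (- val D * w / val e)).
  have -> : val e * (- val D * w / val e) = - val D * w by field.
  by have -> : 0 + val t * 1 = - val D * val (mob (N.succ m)) by rewrite ev; field.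
have fu : isf m u by move: le_u ne_u; rewrite /isf /q /mm; clear; lia.
have [u0|nzu] := eqVneq u N0.
  rewrite u0 mob0 eqxx; split; first by rewrite /q /mm; lia.
  move=> w; have := covers_act (cov (w / val e)).
  have -> : val e * (w / val e) = w by field.
  by rewrite u0 /= !mulr0 addr0.
have [fv ev] := mobP fu nzu; split; first exact: ltnW.
case: eqP => [ei|_ w]; first by move: fv; rewrite ei /isf; clear; lia.
have nvu : val u != 0 by rewrite (fval_eq0 m_gt0 th_m).
apply: (coversZ (c := - (val D * val u))); first by rewrite oppr_eq0 mulf_neq0.
have := covers_act (cov (- (val D * val u) * w / val e)).
have -> : val e * (- (val D * val u) * w / val e) = - (val D * val u) * w by field.
have -> : 1 + val t * val u = - (val D * val u) * val (mob u).
  by rewrite ev; field; rewrite nvu.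
by rewrite mulr1 mulNr.
Qed.
End Invariant.

Hypothesis K_act : (1 < order)%N -> {in K, forall ab, act ab \in K /\ ab.1 != N0}.

Definition marked_ok (V : PositiveMap.t unit) : Prop :=
  forall x, PositiveMap.find (N.succ_pos x) V -> column_covered x.

Lemma succ_pos_inj x y : N.succ_pos x = N.succ_pos y -> x = y.
Proof. lia. Qed.

Lemma mark_ok n u V : (n <= order)%N -> (N.to_nat u <= q)%N -> column_covered u ->
  marked_ok V -> marked_ok (mark m mp m1 D t n u V).
Proof.
elim: n u V => //= n IH u V le_n le_u cu okV.
have okV' : marked_ok (PositiveMap.add (N.succ_pos u) tt V).
  move=> x; have [->//|ne_x] := N.eq_dec x u.
  have ne : N.succ_pos x <> N.succ_pos u by move/succ_pos_inj.
  by rewrite PositiveMap.gso //; apply: okV.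
(* The last mark needs no image, so invariance is only invoked when [order] exceeds 1. *)
case: n IH le_n => [|n] IH le_n //.
have order_gt1 : (1 < order)%N by apply: leq_trans le_n.
have [le_v cv] := column_covered_mob (K_act order_gt1) le_u cu.
by apply: IH => //; apply: ltnW.
Qed.

Let rows := row_table nd q sp K.
Let cols := col_table nd m q sp K.
Let ts := dir_table nd m cols rows K.
Hypothesis ts_ok : all not_bad ts.
Hypothesis K_gt1 : (1 < size K)%N.

Lemma sweepP V : sweep m mp m1 D t order ts rows N0 cols (PositiveMap.empty unit) = Some V ->
  marked_ok V /\ forall u, isf m u -> column_covered u.
Proof.
have szcols : size cols = q.
  rewrite /cols /col_table size_transpose // => s /List.in_map_iff[ab [<- _]].
  exact: (size_line size_sp (fun x => dlog_of nd (finv m x))).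
have ok0 : marked_ok (PositiveMap.empty unit) by move=> x; rewrite PositiveMap.gempty.
(* Generalized to the columns from i on, all earlier ones being covered. *)
suff H i V0 : (i <= q)%N -> marked_ok V0 -> (forall u, (N.to_nat u < i)%N -> column_covered u) ->
    sweep m mp m1 D t order ts rows (N.of_nat i) (drop i cols) V0 = Some V ->
    marked_ok V /\ forall u, isf m u -> column_covered u.
  by move=> e0; apply: (H 0%N (PositiveMap.empty unit)) => //; rewrite drop0.
elim: {i}(q - i)%N {-2}i (erefl (q - i)%N) V0 => [|k IH] i ek V0 le_i okV0 cov.
  rewrite drop_oversize ?szcols /=; last by lia.
  by case=> <-; split=> // u fu; apply: cov; apply: leq_trans fu _; rewrite -/q; lia.
have lti : (i < q)%N by lia.
rewrite (drop_nth [::]) ?szcols //=.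
have -> : N.succ (N.of_nat i) = N.of_nat i.+1 by clear; lia.
have fi : isf m (N.of_nat i) by rewrite /isf Nat2N.id.
have next V1 : marked_ok V1 -> column_covered (N.of_nat i) ->
    sweep m mp m1 D t order ts rows (N.of_nat i.+1) (drop i.+1 cols) V1 = Some V ->
    marked_ok V /\ forall u, isf m u -> column_covered u.
  move=> okV1 ci; apply: IH => //; first by lia.
  move=> u; rewrite ltnS leq_eqVlt => /orP[/eqP eu|]; last exact: cov.
  by have -> : u = N.of_nat i by lia.
case ef : (PositiveMap.find _ V0) => [x|].
  by apply: next => //; apply: okV0; rewrite ef.
case: ifP => // cok; have ci : column_covered (N.of_nat i).
  rewrite /column_covered; case: eqP => [ei|_]; first by move: fi; rewrite /isf ei; clear; lia.
  have cc := column_covers m_gt0 le_nd th_m size_sp spP K_isf ts_ok K_gt1 val_surj fi.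
  by apply: cc; rewrite Nat2N.id.
apply: next => //; apply: mark_ok => //; first by rewrite Nat2N.id ltnW.
Qed.

Lemma infinityP : infinity_ok m mp q K -> forall w, covers 0 1 w.
Proof.
move=> /allP ok w; have [x fx <-] := val_surj w.
have /ok/hasP[ab abK /hasP[cd cdK /andP[ne /eqP ex]]] : x \in [seq N.of_nat i | i <- iota 0 q].
  by apply/mapP; exists (N.to_nat x); rewrite ?mem_iota ?N2Nat.id.
have [fa fb] := K_isf abK; have [fc fd] := K_isf cdK.
have [f1 e1] := fsubP m_gt0 th_m size_sp spP fb fd.
have [f2 e2] := fsubP m_gt0 th_m size_sp spP fa fc.
have [f3 e3] := fmulP m_gt0 th_m fx f2.
exists (pt th ab), (pt th cd); split; rewrite ?map_f //.
  have uK := uniq_pts m_gt0 le_nd th_m size_sp spP K_isf ts_ok.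
  apply: contra ne => /eqP ept; apply/eqP; move/(uniqP (pt th (N0, N0))): uK => inj.
  rewrite -(nth_index (N0, N0) abK) -(nth_index (N0, N0) cdK); congr (nth _ _ _).
  by apply: inj; rewrite ?inE ?size_map ?index_mem // !(nth_map (N0, N0)) ?index_mem // !nth_index.
have := congr1 val ex; rewrite e1 e3 e2 => h.
have h' : val ab.2 = val cd.2 + val x * (val ab.1 - val cd.1) by rewrite -h; ring.
by rewrite /det3 /= h'; ring.
Qed.

Lemma verticalP : has vertical ts -> covers 0 0 1.
Proof.
case/(has_nthP Bad) => i; rewrite (size_ts nd size_sp K_isf) => lti.
have := tsP m_gt0 le_nd th_m size_sp spP K_isf ts_ok lti.
case: (nth Bad ts i) => // ? ? v ? [_ _ [_ ev _] _] /= vt.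
have aK := mem_nth (N0, N0) lti; move: (nth _ K i) aK ev => a aK ev.
move: ev; rewrite vt => /esym/mapP[c cK ec].
have [fa fa'] := K_isf aK; have [fc fc'] := K_isf cK.
exists (pt th a), (pt th c); split; rewrite ?map_f //.
  (* The class of c is m + 1, not the code m + 2 of a itself. *)
  rewrite eq_sym; apply/eqP => /(clsP_self m_gt0 le_nd th_m size_sp spP ts_ok (conj fc fc') (conj fa fa')).
  by rewrite -ec /mm; clear; lia.
move: ec; have [ex _] := CentP nd m_gt0 th_m size_sp spP fc fa.
move: ex; rewrite /= ; case: (dlog_of _ _) => [|dd ii] /=.
  rewrite invr0 => /esym/eqP; rewrite (offset_eq0) => /eqP ex _.
  by rewrite /det3 /= ex; ring.
by move=> _; case: (dlog_of _ _) => [|d' i'] /=; [clear; lia | have := ltn_pmod (N.to_nat ii + N.to_nat i')%N m_gt0; rewrite /mm; clear; lia].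
Qed.
End Complete.

(** * Powers of X modulo f, and the table of x - 1 *)

Section Vectors.
Variables (p : N) (r : seq N).

(** One pass shifts the coefficients up and replaces the overflowing term [top] X^h by [top] times
    the sum of the r_i X^i. *)
Fixpoint shift_add (top prev : N) (v r : seq N) : seq N :=
  match v, r with
  | c :: v, x :: r => N.modulo (N.add prev (N.mul top x)) p :: shift_add top c v r
  | _, _ => [::]
  end.

(* multiplication by [X] modulo [f], in the basis 1, X, X^2, ... *)
Definition step (v : seq N) := shift_add (last N0 v) N0 v r.

Definition one_vec := N.modulo 1 p :: nseq (size r).-1 N0.
Definition vecs (n : nat) := nseq (size r) N0 :: traject step one_vec n.

(** A search key only: [preds] compares the vector found with the one sought, so correctness does
    not rest on injectivity. *)
Definition key (v : seq N) : positive := N.succ_pos (foldr (fun c k => N.add c (N.mul p k)) N0 v).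

Fixpoint index_map (i : N) (vs : seq (seq N)) (mp : PositiveMap.t (N * seq N)) :=
  if vs is v :: vs then index_map (N.succ i) vs (PositiveMap.add (key v) (i, v) mp) else mp.

Definition dec (v : seq N) : seq N :=
  if v is c :: v then (if c is N0 then N.pred p else N.pred c) :: v else [::].

(* The table of x |-> x - 1.  [n.+1] is a junk value, excluded by [field_ok]. *)
Definition preds (n : nat) : seq N :=
  let vs := vecs n in
  let mp := index_map N0 vs (PositiveMap.empty (N * seq N)) in
  map (fun v => if PositiveMap.find (key (dec v)) mp is Some (i, v')
                then if v' == dec v then i else N.of_nat n.+1 else N.of_nat n.+1) vs.

(** The first two table entries belong to 0 and 1. That no later predecessor is 0 says that theta^i
    differs from 1 for 0 < i < n; with X^n = 1 modulo f this makes theta primitive. *)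
Definition field_ok (n : nat) (sp : seq N) : bool :=
  [&& 0 < size r, 0 < n, iter n step one_vec == one_vec,
      all (fun x => N.ltb x (N.of_nat n.+1)) sp & all (fun x => x != N0) (drop 2 sp)].
End Vectors.

Lemma find_index_map p k i vs mp j v :
  PositiveMap.find k (index_map p i vs mp) = Some (j, v) ->
  PositiveMap.find k mp = Some (j, v) \/
  [/\ N.to_nat i <= N.to_nat j, N.to_nat j < N.to_nat i + size vs
    & nth [::] vs (N.to_nat j - N.to_nat i) = v].
Proof.
elim: vs i mp => [|w vs IH] i mp /=; first by left.
case/IH => [|[le_j lt_j <-]]; last first.
  right; split; try lia.
  by have -> : N.to_nat j - N.to_nat i = (N.to_nat j - N.to_nat (N.succ i)).+1 by lia.
have [->|ne] := Pos.eq_dec k (key p w); last by rewrite PositiveMap.gso //; left.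
by rewrite PositiveMap.gss => -[<- <-]; right; rewrite subnn; split=> //; lia.
Qed.

(** * A primitive root of f in an arbitrary field of order q *)

Section FieldRoot.
Local Open Scope ring_scope.
Variables (F : finFieldType) (p : N) (r : seq N) (n : nat).
Hypothesis cardF : #|F| = n.+1.
Hypothesis p_char : (N.to_nat p)%:R = 0 :> F.
Hypothesis p_gt0 : (0 < N.to_nat p)%N.
Hypothesis ok : field_ok p r n (preds p r n).

Let h := size r.
Let natF (c : N) : F := (N.to_nat c)%:R.
Let pol (v : seq N) : {poly F} := foldr (fun c P => (natF c)%:P + 'X * P) 0 v.
Let f := 'X^h - pol r.

Lemma natF_mod a : natF (N.modulo a p) = natF a.
Proof.
have p0 : p <> N0 by move: p_gt0; lia.
rewrite /natF {2}(N.div_mod a p p0).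
have -> : N.to_nat (N.add (N.mul p (N.div a p)) (N.modulo a p)) =
   (N.to_nat p * N.to_nat (N.div a p) + N.to_nat (N.modulo a p))%N by lia.
by rewrite natrD natrM p_char mul0r add0r.
Qed.

Lemma natF_add a b : natF (N.add a b) = natF a + natF b.
Proof. by rewrite /natF -natrD; congr (_%:R); lia. Qed.

Lemma natF_mul a b : natF (N.mul a b) = natF a * natF b.
Proof. by rewrite /natF -natrM; congr (_%:R); lia. Qed.

(** Multiplication by X with the incoming constant [prev]; the coefficient pushed out at the top is
    restored on the left. *)
Lemma pol_shift_add top prev v r' : size v = size r' ->
  pol (shift_add p top prev v r') + (natF (last prev v))%:P * 'X^(size v) =
  (natF prev)%:P + 'X * pol v + (natF top)%:P * pol r'.
Proof.
elim: v r' prev => [|c v IH] [|x r'] prev //= => [_|[sz]].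
  by rewrite add0r expr0 !mulr1 !mulr0 !addr0.
have := IH r' c sz; rewrite natF_mod natF_add natF_mul !polyCD polyCM exprS => e.
transitivity ((natF prev)%:P + (natF top)%:P * (natF x)%:P +
  'X * (pol (shift_add p top c v r') + (natF (last c v))%:P * 'X^(size v))); first by ring.
by rewrite e; ring.
Qed.

Lemma size_shift_add top prev v r' : size v = size r' -> size (shift_add p top prev v r') = size v.
Proof. by elim: v r' prev => [|c v IH] [|x r'] prev //= [sz]; rewrite IH. Qed.

Lemma pol_step v : size v = h -> 'X * pol v = pol (step p r v) + (natF (last N0 v))%:P * f.
Proof.
move=> sz; have := pol_shift_add (last N0 v) N0 sz.
rewrite sz {2}/natF /= polyC0 add0r => /esym e.
by rewrite -/(step p r v) in e; rewrite /f mulrBr addrA -e; ring.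
Qed.

Lemma h_gt0 : (0 < h)%N. Proof. by case/and5P: ok. Qed.

Lemma size_one_vec : size (one_vec p r) = h.
Proof. by rewrite /one_vec /= size_nseq prednK // h_gt0. Qed.

Lemma size_iter_step i : size (iter i (step p r) (one_vec p r)) = h.
Proof. by elim: i => [|i IH]; rewrite ?size_one_vec // iterS size_shift_add. Qed.

Lemma pol_nseq k : pol (nseq k N0) = 0.
Proof. by elim: k => //= k ->; rewrite mulr0 addr0 /natF polyC0. Qed.

Lemma pol_one : pol (one_vec p r) = 1.
Proof. by rewrite /one_vec /= pol_nseq mulr0 addr0 natF_mod. Qed.

Lemma pol_iter_step i : f %| 'X^i - pol (iter i (step p r) (one_vec p r)).
Proof.
elim: i => [|i IH]; first by rewrite pol_one subrr dvdp0.
rewrite iterS exprS; set v := iter i _ _ in IH *.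
have e := pol_step (size_iter_step i); rewrite -/v in e.
have -> : 'X * 'X^i - pol (step p r v) = 'X * ('X^i - pol v) + (natF (last N0 v))%:P * f.
  by rewrite mulrBr e; ring.
by rewrite dvdp_add ?dvdp_mull.
Qed.

Lemma size_pol v : (size (pol v) <= size v)%N.
Proof.
elim: v => [|c v IH] /=; first by rewrite size_poly0.
rewrite (leq_trans (size_polyD _ _)) // geq_max (leq_trans (size_polyC_leq1 _)) //=.
by rewrite (leq_trans (size_polyMleq _ _)) // size_polyX.
Qed.

Lemma size_f : size f = h.+1.
Proof. by rewrite /f size_polyDl size_polyXn // size_polyN ltnS size_pol. Qed.

Lemma root_exists : exists th : F, root f th.
Proof.
have f_dvd : f %| \prod_(x <- enum F) ('X - x%:P).
  have -> : \prod_(x <- enum F) ('X - x%:P) = 'X^#|F| - 'X :> {poly F}.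
    by rewrite finField_genPoly big_enum.
  have [_ _ /eqP it _ _] := and5P ok.
  have := pol_iter_step n; rewrite it pol_one => dv.
  by rewrite cardF (_ : _ - 'X = 'X * ('X^n - 1)) ?dvdp_mull // mulrBr mulr1 exprS.
(* A divisor of the split polynomial is, up to a unit, the product over a sublist of F. The sublist
   is nonempty because f has degree h > 0. *)
have [ms] := dvdp_prod_XsubC f_dvd; case e : (mask ms _) => [|x s].
  rewrite big_nil => /eqp_size; rewrite size_f size_poly1 => -[h0].
  by have := h_gt0; rewrite h0.
move/eqp_root => re; exists x; rewrite re big_cons rootM root_XsubC eqxx //.
Qed.

Section Root.
Variable th : F.
Hypothesis root_th : root f th.
Let ev (v : seq N) : F := (pol v).[th].
Let m := N.of_nat n.
Let sp := preds p r n.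

Lemma ev_iter i : th ^+ i = ev (iter i (step p r) (one_vec p r)).
Proof.
have /dvdpP[Q e] := pol_iter_step i.
have := congr1 (horner^~ th) e; rewrite hornerM (eqP root_th) mulr0 hornerD hornerN hornerXn => /eqP.
by rewrite subr_eq0 => /eqP.
Qed.

Lemma root_order : th ^+ n = 1.
Proof.
have [_ _ /eqP it _ _] := and5P ok.
by rewrite ev_iter it /ev pol_one hornerE.
Qed.

Lemma size_preds : size sp = n.+1.
Proof. by rewrite /sp /preds size_map /vecs /= size_traject. Qed.

Lemma nth_vecs i : (i < n)%N -> nth [::] (vecs p r n) i.+1 = iter i (step p r) (one_vec p r).
Proof.
by move=> lt_i; rewrite /vecs /= (set_nth_default (one_vec p r)) ?size_traject // nth_traject.
Qed.

Lemma fval_vecs x : isf m x -> fval th x = ev (nth [::] (vecs p r n) (N.to_nat x)).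
Proof.
rewrite /isf Nat2N.id; case: x => [|x] fx; first by rewrite /vecs /ev /= pol_nseq horner0.
have -> : N.to_nat (Npos x) = (N.to_nat (N.pred (Npos x))).+1 by lia.
have : (N.to_nat (N.pred (Npos x)) < n)%N by lia.
rewrite /fval; move: (N.to_nat (N.pred _)) => i lt_i.
by rewrite nth_vecs // -ev_iter.
Qed.

Lemma ev_dec v : size v = h -> ev (dec p v) = ev v - 1.
Proof.
have := h_gt0; case: v => [|c v] hp sz; first by rewrite -sz in hp.
rewrite /ev /= !hornerE; have -> // : natF (if c is N0 then N.pred p else N.pred c) = natF c - 1.
  rewrite /natF; case: c sz => [|c] _.
    rewrite sub0r; apply/eqP; rewrite -subr_eq0 opprK natr1.
    by rewrite (_ : (N.to_nat (N.pred p)).+1 = N.to_nat p) ?p_char //; move: p_gt0; lia.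
  by rewrite (_ : N.to_nat (Npos c) = (N.to_nat (N.pred (Npos c))).+1) ?natrS; [ring | lia].
by ring.
Qed.

Lemma size_vecs x : isf m x -> size (nth [::] (vecs p r n) (N.to_nat x)) = h.
Proof.
rewrite /isf Nat2N.id; case: (N.to_nat x) => [|i] lti; first by rewrite /vecs /= size_nseq.
by rewrite nth_vecs // size_iter_step.
Qed.

(** The range test rules out the junk value, so the search succeeded and the vector found is [dec]
    of the one at x; evaluating both at theta gives the equation. *)
Lemma predsP x : isf m x -> isf m (nth N0 sp (N.to_nat x))
  /\ fval th (nth N0 sp (N.to_nat x)) = fval th x - 1.
Proof.
move=> fx; have [_ _ _ /allP lt _] := and5P ok.
have ltx : (N.to_nat x < size sp)%N by rewrite size_preds; move: fx; rewrite /isf Nat2N.id.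
have lt_sp := lt _ (mem_nth N0 ltx).
have fs : isf m (nth N0 sp (N.to_nat x)).
  move: lt_sp; rewrite /isf /m Nat2N.id -/sp; case: N.ltb_spec => // lt_x _.
  by move: lt_x; move: (nth _ _ _) => y; clear; lia.
split=> //; rewrite fval_vecs // fval_vecs // -ev_dec ?size_vecs //.
have szv : (N.to_nat x < size (vecs p r n))%N by move: ltx; rewrite size_preds /vecs /= size_traject.
move: lt_sp; rewrite /sp /preds (nth_map [::]) //; set v := nth _ (vecs p r n) _.
case e : PositiveMap.find => [[i v']|]; last by rewrite N.ltb_irrefl.
case: eqP => [ev' _|_]; last by rewrite N.ltb_irrefl.
have [|[_ _]] := find_index_map e; first by rewrite PositiveMap.gempty.
by rewrite subn0 => ->; rewrite ev'.
Qed.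

Lemma n_gt0 : (0 < n)%N. Proof. by case/and5P: ok. Qed.

(** If theta^a = theta^b with a < b, then theta^(b - a) = 1 has predecessor 0, which [field_ok]
    forbids. *)
Lemma root_inj i j : (i < n)%N -> (j < n)%N -> th ^+ i = th ^+ j -> i = j.
Proof.
have mE : N.to_nat m = n by rewrite Nat2N.id.
have th_m : th ^+ N.to_nat m = 1 by rewrite mE root_order.
have m_gt0 : (0 < N.to_nat m)%N by rewrite mE n_gt0.
have nz := th_neq0 m_gt0 th_m.
have H a b : (a < b)%N -> (b < n)%N -> th ^+ a = th ^+ b -> False.
  move=> lt_ab lt_b e; have [_ _ _ _ /allP nz2] := and5P ok.
  pose x := N.of_nat (b - a).+1.
  have fx : isf m x by rewrite /isf /x !Nat2N.id; lia.
  have [fs es] := predsP fx.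
  have : fval th (nth N0 sp (N.to_nat x)) == 0.
    have -> : x = N.succ (N.of_nat (b - a)) by rewrite /x; lia.
    have := predsP fx; rewrite (_ : x = N.succ (N.of_nat (b - a))); last by rewrite /x; lia.
    case=> _ ->; rewrite fval_succ Nat2N.id subr_eq0; apply/eqP.
    by apply: (mulIf (expf_neq0 a nz)); rewrite -exprD subnK ?(ltnW lt_ab) // mul1r e.
  rewrite (fval_eq0 m_gt0 th_m) => /eqP e0.
  (* The code of theta^(b - a) is b - a + 1, at least 2. *)
  have /nz2 : nth N0 sp (N.to_nat x) \in drop 2 sp.
    rewrite /x Nat2N.id; have -> : (b - a).+1 = (2 + (b - a).-1)%N by lia.
    by rewrite -nth_drop mem_nth // size_drop size_preds; lia.
  by rewrite e0.
move=> lti ltj e; case: (ltngtP i j) => // lt; first by case: (H i j lt ltj e).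
by case: (H j i lt lti (esym e)).
Qed.

(** The n + 1 codes have distinct values in a field of n + 1 elements. *)
Lemma fval_surj (y : F) : exists2 x, isf m x & fval th x = y.
Proof.
have mE : N.to_nat m = n by rewrite Nat2N.id.
have th_m : th ^+ N.to_nat m = 1 by rewrite mE root_order.
have m_gt0 : (0 < N.to_nat m)%N by rewrite mE n_gt0.
have nz := th_neq0 m_gt0 th_m.
pose g (i : 'I_n.+1) := fval th (N.of_nat i).
have g_inj : injective g.
  move=> [[|i] lti] [[|j] ltj]; rewrite /g /= => e; apply: val_inj => //=.
  - by move/esym/eqP: e; rewrite (fval_eq0 m_gt0 th_m (Npos _)).
  - by move/eqP: e; rewrite (fval_eq0 m_gt0 th_m (Npos _)).
  have := fval_succ th (N.of_nat i); have := fval_succ th (N.of_nat j).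
  rewrite -!Nat2N.inj_succ !Nat2N.id /= => ej ei; congr _.+1.
  by apply: root_inj => //; rewrite -ei -ej.
have /codomP[i ->] : y \in codom g.
  by apply: inj_card_onto; rewrite ?card_ord ?cardF.
by exists (N.of_nat i) => //; rewrite /isf !Nat2N.id.
Qed.
End Root.
End FieldRoot.

(** * From point lists to [t2] *)

(** The characteristic divides p ^ h, hence p. *)
Lemma char_of_card (F : finFieldType) p h : #|F| = (p ^ h)%N -> (p%:R = 0 :> F)%R.
Proof.
move=> cardF; have [p' pr_p' charF] := finPcharP F.
have : (p' %| p ^ h)%N.
  rewrite -cardF (card_pprimeChar charF) dvdn_exp // lt0n.
  apply/eqP => n0; have := finNzRing_gt1 F.
  by rewrite (card_pprimeChar charF) n0.
rewrite Euclid_dvdX // => /andP[/dvdnP[k ->] _].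
by rewrite natrM (pcharf0 charF) mulr0.
Qed.

Lemma bigminn_le (I : finType) (P : pred I) (f : I -> nat) d i : P i ->
  \big[minn/d]_(j | P j) f j <= f i.
Proof.
move=> Pi; have : i \in index_enum I by rewrite mem_index_enum.
elim: (index_enum I) => //= j s IH; rewrite inE big_cons => /orP[/eqP <-|/IH le_s].
  by rewrite Pi geq_minl.
by case: ifP => // _; rewrite (leq_trans (geq_minr _ _)).
Qed.

Section Determinant.
Local Open Scope ring_scope.

Lemma det_mx33 (R : comNzRingType) (f : nat -> nat -> R) :
  \det (\matrix_(i < 3, j < 3) f i j) =
  f 0 0 * (f 1 1 * f 2 2 - f 1 2 * f 2 1) - f 0 1 * (f 1 0 * f 2 2 - f 1 2 * f 2 0)
  + f 0 2 * (f 1 0 * f 2 1 - f 1 1 * f 2 0).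
Proof.
rewrite (expand_det_row _ ord0) !big_ord_recl big_ord0 /cofactor.
rewrite !(expand_det_row _ ord0) !big_ord_recl !big_ord0 /cofactor !det_mx11 !mxE /= /bump /=.
by rewrite !addn0 !add0n !addn1 /= !expr0 !expr1 !expr2; ring.
Qed.

End Determinant.

Section Plane.
Local Open Scope ring_scope.
Variables (F : finFieldType).

Definition vec3 (x y z : F) : 'rV[F]_3 := \row_j nth 0 [:: x; y; z] j.

Lemma vec3_normalized y z : normalized (vec3 1 y z).
Proof.
apply/existsP; exists ord0; rewrite mxE eqxx /=.
exact/forallP.
Qed.

Definition affine_point (A : F * F) : pg2_point F :=
  exist _ (vec3 1 A.1 A.2) (vec3_normalized A.1 A.2).

Lemma affine_point_inj : injective affine_point.
Proof.
move=> [a b] [c d] /(congr1 val)/rowP e.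
have := e (inord 1); have := e (inord 2); rewrite !mxE /= !inordK //=.
by move=> -> ->.
Qed.

Lemma vec3_coord (v : 'rV[F]_3) (j : 'I_3) :
  v ord0 j = nth 0 [:: v ord0 (inord 0); v ord0 (inord 1); v ord0 (inord 2)] j.
Proof. by case: j => [[|[|[|j]]] lt_j] //=; congr (v _ _); apply: val_inj; rewrite /= inordK. Qed.

Lemma collinear_det3 (P : pg2_point F) (A B : F * F) :
  collinear P (affine_point A) (affine_point B) =
  (det3 (val P ord0 (inord 0)) (val P ord0 (inord 1)) (val P ord0 (inord 2)) A B == 0).
Proof.
rewrite /collinear.
pose f i j : F := nth 0 (nth [::] [:: [:: val P ord0 (inord 0); val P ord0 (inord 1); val P ord0 (inord 2)];
   [:: 1; A.1; A.2]; [:: 1; B.1; B.2]] i) j.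
have -> : \matrix_(i < 3, j < 3) (nth 0 [:: val P; val (affine_point A); val (affine_point B)] i) ord0 j
    = \matrix_(i < 3, j < 3) f i j.
  apply/matrixP => i j; rewrite !mxE /f.
  by case: i => [[|[|[|i]]] lt_i] //=; rewrite ?mxE // -vec3_coord.
rewrite det_mx33 /f /det3 /=; congr (_ == 0); ring.
Qed.

Lemma normalized_cases (v : 'rV[F]_3) : normalized v ->
  [\/ v ord0 (inord 0) = 1,
      v ord0 (inord 0) = 0 /\ v ord0 (inord 1) = 1 |
      [/\ v ord0 (inord 0) = 0, v ord0 (inord 1) = 0 & v ord0 (inord 2) = 1]].
Proof.
case/existsP=> i /andP[/eqP vi /forallP v0].
have z (k : nat) : (k < i)%N -> v ord0 (inord k) = 0.
  move=> lt_k; have lt3 : (k < 3)%N := ltn_trans lt_k (ltn_ord i).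
  by have /implyP := v0 (inord k); rewrite inordK // => /(_ lt_k)/eqP.
have ei : i = inord i by rewrite inord_val.
rewrite ei in vi; move: vi z; case: i {ei v0} => [[|[|[|i]]] lt_i] //= vi z.
- by constructor 1.
- by constructor 2; split; [apply: z | exact: vi].
- by constructor 3; split; [apply: z | apply: z | exact: vi].
Qed.

(** A point outside the arc lies on a secant, so adding it creates three collinear points; the arc
    is thus complete and takes part in the minimum. *)
Lemma t2_le (S : seq (F * F)) :
  {in S & &, forall A B C, A != B -> A != C -> B != C -> det3 1 A.1 A.2 B C != 0} ->
  (forall v, normalized v -> exists A B, [/\ A \in S, B \in S, A != B
     & det3 (v ord0 (inord 0)) (v ord0 (inord 1)) (v ord0 (inord 2)) A B = 0]) ->
  (t2 F <= size S)%N.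
Proof.
move=> arcS covS; pose X := [set x in map affine_point S].
have compX : complete_arc X.
  apply/andP; split.
    apply/forall_inP => a; rewrite inE => /mapP[A AS ->].
    apply/forall_inP => b; rewrite inE => /mapP[B BS ->].
    apply/forall_inP => c; rewrite inE => /mapP[C CS ->].
    apply/implyP => /and3P[]; rewrite !(inj_eq affine_point_inj) => nAB nAC nBC.
    rewrite collinear_det3 /affine_point /= !mxE /= !inordK //=.
    exact: arcS.
  apply/forallP => x; apply/implyP => xX.
  have [A [B [AS BS nAB d0]]] := covS _ (valP x).
  have inX C : C \in S -> affine_point C \in X by move=> CS; rewrite inE map_f.
  (* The arc condition for x and the two arc points A, B of a secant through x. *)
  apply/negP => /forall_inP/(_ x (setU11 _ _))/forall_inP.
  move/(_ (affine_point A)); rewrite inE inX // orbT => /(_ isT)/forall_inP.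
  move/(_ (affine_point B)); rewrite inE inX // orbT => /(_ isT).
  rewrite collinear_det3 d0 eqxx (inj_eq affine_point_inj) nAB andbT implybF.
  by rewrite !(contraNneq _ xX) // => ->; apply: inX.
rewrite (leq_trans (bigminn_le _ _ compX)) // cardsE (leq_trans (card_size _)) //.
by rewrite size_map.
Qed.
End Plane.

(** * Certificates and their soundness *)

(** [arc_r] holds the coefficients r_i of f, constant term first. D, t, e and all coordinates are
    codes, so 1 stands for the element 1. [arc_order] is the number of lines marked from each tested
    one. *)
Record arc_data := ArcData {
  arc_p : nat; arc_r : seq N; arc_order : nat;
  arc_D : N; arc_t : N; arc_e : N; arc_reps : seq (N * (N * N)) }.

(** Enough base 4 digits for a sum of two logarithms below n. *)
Definition ndigits (n : nat) := (trunc_log 4 (2 * n)).+1.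

Definition arc_size (d : arc_data) := sumn [seq N.to_nat r.1 | r <- arc_reps d].
Definition arc_q (d : arc_data) := (arc_p d ^ size (arc_r d)).

Definition check_arc (d : arc_data) : bool :=
  let: ArcData p0 r order D t e reps := d in
  let p := N.of_nat p0 in
  let n := (p0 ^ size r).-1 in
  let sp := preds p r n in
  [&& (0 < p0)%N, field_ok p r n sp & arc_ok (ndigits n) (N.of_nat n) sp D t e order reps].

Section CheckArc.
Local Open Scope ring_scope.

Lemma check_arcP (F : finFieldType) d : check_arc d -> #|F| = arc_q d -> (t2 F <= arc_size d)%N.
Proof.
case: d => p0 r order D t e reps /and3P[p0_gt0]; rewrite /arc_q /arc_size /=.
set p := N.of_nat p0; set n := (p0 ^ size r).-1 => fok aok cardF.
have cardF' : #|F| = n.+1 by rewrite cardF /n prednK // expn_gt0 p0_gt0.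
have pE : N.to_nat p = p0 by rewrite /p Nat2N.id.
have p_char : (N.to_nat p)%:R = 0 :> F by rewrite pE; apply: char_of_card cardF.
have p_gt0 : (0 < N.to_nat p)%N by rewrite pE.
have [th root_th] := root_exists cardF' p_char p_gt0 fok.
pose m := N.of_nat n; have mE : N.to_nat m = n by rewrite /m Nat2N.id.
have m_gt0 : (0 < N.to_nat m)%N by rewrite mE; case/and5P: fok.
have th_m : th ^+ N.to_nat m = 1 by rewrite mE; exact: (root_order cardF' p_char p_gt0 fok root_th).
have th_inj i j : (i < N.to_nat m)%N -> (j < N.to_nat m)%N -> th ^+ i = th ^+ j -> i = j.
  by rewrite mE; exact: (root_inj cardF' p_char p_gt0 fok root_th).
have size_sp : size (preds p r n) = (N.to_nat m).+1 by rewrite mE size_preds.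
have spP := predsP cardF' p_char p_gt0 fok root_th.
have val_surj := fval_surj cardF' p_char p_gt0 fok root_th.
have le_nd : (2 * N.to_nat m <= 4 ^ ndigits n)%N by rewrite mE ltnW // trunc_log_ltn.
move: aok; rewrite /arc_ok -/m; set K := points _ _ _ _ _ _ _.
case/and5P=> ltD ltt lte nzD /and5P[nze pok K_gt1 ts_ok /andP[vert]].
have isfE x : N.ltb x (N.succ m) -> isf m x.
  by rewrite /isf; case: N.ltb_spec => // lt_x _; move: lt_x; clear; lia.
have fD := isfE _ ltD; have ft := isfE _ ltt; have fe := isfE _ lte.
case/andP: pok => /allP reps_lt pok.
have reps_isf : {in reps, forall r, isf m r.2.1 /\ isf m r.2.2}.
  by move=> ab /reps_lt/andP[/isfE ? /isfE ?].
have K_act : (1 < order)%N -> {in K, forall ab, act m (to_map N0 (preds p r n) (PositiveMap.empty N))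
    (head N0 (preds p r n)) D t e ab \in K /\ ab.1 != N0}.
  move=> order_gt1 ab /flattenP[s /mapP[r0 r0reps ->{s}] abs].
  move: pok; rewrite gtn_eqF //= => /allP/(_ _ r0reps)/andP[/eqP it /allP/(_ _ abs) nz].
  split=> //; apply/flattenP; exists (traject (act m (to_map N0 (preds p r n) (PositiveMap.empty N))
    (head N0 (preds p r n)) D t e) r0.2 (N.to_nat r0.1)); first exact: map_f.
  exact: mem_traject_closed.
have fK := K_isf m_gt0 th_m size_sp spP fD ft fe reps_isf.
case sw : sweep => [V|] // inf.
have [okV cov] := sweepP m_gt0 le_nd th_m size_sp spP val_surj fD ft fe nzD nze reps_isf K_act ts_ok K_gt1 sw.
have cov1 u w : covers th K 1 u w.
  have [x fx <-] := val_surj u; have := cov x fx; rewrite /column_covered.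
  case: eqP => [ex|_ /(_ w)//]; move: fx; rewrite ex /isf; clear; lia.
have cov_inf w : covers th K 0 1 w.
  move: inf; case fi : PositiveMap.find => [x|] inf; last first.
    exact: (infinityP m_gt0 le_nd th_m size_sp spP val_surj fD ft fe reps_isf ts_ok inf).
  by have := okV (N.succ m); rewrite fi => /(_ isT); rewrite /column_covered eqxx.
have cov0 := verticalP m_gt0 le_nd th_m size_sp spP fD ft fe reps_isf ts_ok vert.
(* The size is the sum of the orbit lengths, known without computing the points. *)
have -> : sumn [seq N.to_nat r.1 | r <- reps] = size (map (pt th) K).
  rewrite size_map size_flatten /shape -map_comp; congr sumn.
  by apply: eq_map => x /=; rewrite size_traject.
have arcK := arc_pts m_gt0 le_nd th_m th_inj size_sp spP fK ts_ok.
apply: t2_le => [A B C|v /normalized_cases].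
  exact: arcK.
case=> [->|[-> ->]|[-> -> ->]].
- exact: cov1.
- exact: cov_inf.
- exact: cov0.
Qed.

End CheckArc.

Local Open Scope N_scope.
Local Open Scope seq_scope.

(** One entry for each prime power of the range, in increasing order. For prime q the polynomial is
    X - g, and theta is the residue g. *)
Definition arcs : seq arc_data :=
  [:: ArcData 2 [:: 1] 1 1 0 1 [:: (1, (1, 1)); (1, (1, 0)); (1, (0, 0)); (1, (0, 1))];
      ArcData 3 [:: 2] 4 1 0 1 [:: (4, (1, 1))];
      ArcData 2 [:: 1; 1] 1 1 0 1 [:: (1, (0, 1)); (1, (3, 1)); (1, (1, 3)); (1, (0, 0)); (1, (1, 0)); (1, (3, 3))];
      ArcData 5 [:: 2] 6 1 1 1 [:: (6, (2, 3))];
      ArcData 7 [:: 3] 4 1 0 1 [:: (4, (4, 3)); (2, (3, 0))];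
      ArcData 2 [:: 1; 1; 0] 3 1 1 1 [:: (3, (7, 7)); (3, (4, 3))];
      ArcData 3 [:: 1; 2] 1 1 0 1 [:: (1, (8, 5)); (1, (1, 7)); (1, (7, 2)); (1, (5, 6)); (1, (3, 2)); (1, (8, 6))];
      ArcData 11 [:: 2] 1 1 0 1 [:: (1, (5, 0)); (1, (3, 2)); (1, (5, 10)); (1, (7, 4)); (1, (2, 0)); (1, (0, 5)); (1, (6, 7))];
      ArcData 13 [:: 2] 1 1 0 1 [:: (1, (7, 11)); (1, (6, 6)); (1, (8, 8)); (1, (7, 12)); (1, (12, 5)); (1, (2, 0)); (1, (10, 2)); (1, (1, 11))];
      ArcData 2 [:: 1; 1; 0; 0] 5 4 15 7 [:: (5, (10, 9)); (5, (11, 10))];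
      ArcData 17 [:: 3] 4 5 10 9 [:: (2, (5, 11)); (4, (12, 13)); (4, (7, 13))];
      ArcData 19 [:: 2] 5 1 3 1 [:: (5, (6, 3)); (5, (16, 14))];
      ArcData 23 [:: 5] 1 1 0 1 [:: (1, (11, 11)); (1, (5, 21)); (1, (4, 20)); (1, (8, 0)); (1, (17, 2)); (1, (11, 0)); (1, (14, 3)); (1, (20, 17)); (1, (16, 13)); (1, (14, 14))];
      ArcData 5 [:: 3; 4] 3 1 13 1 [:: (3, (3, 22)); (3, (11, 3)); (3, (10, 21)); (3, (16, 1))];
      ArcData 3 [:: 2; 1; 0] 4 1 0 1 [:: (4, (1, 11)); (4, (22, 4)); (4, (26, 1))];
      ArcData 29 [:: 2] 1 1 0 1 [:: (1, (9, 6)); (1, (14, 2)); (1, (1, 17)); (1, (5, 25)); (1, (5, 12)); (1, (19, 22)); (1, (22, 22)); (1, (15, 0)); (1, (4, 16)); (1, (15, 23)); (1, (4, 6)); (1, (8, 15)); (1, (9, 1))];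
      ArcData 31 [:: 3] 4 1 0 1 [:: (4, (14, 4)); (4, (21, 16)); (4, (23, 9)); (2, (13, 0))];
      ArcData 2 [:: 1; 0; 1; 0; 0] 1 1 0 1 [:: (1, (9, 22)); (1, (11, 25)); (1, (0, 27)); (1, (12, 7)); (1, (25, 21)); (1, (8, 3)); (1, (11, 24)); (1, (24, 15)); (1, (20, 3)); (1, (13, 1)); (1, (14, 0)); (1, (14, 16)); (1, (24, 26)); (1, (26, 0))];
      ArcData 37 [:: 2] 3 13 7 25 [:: (3, (16, 7)); (3, (6, 14)); (3, (28, 7)); (3, (20, 27)); (3, (4, 27))];
      ArcData 41 [:: 6] 4 11 19 21 [:: (4, (32, 6)); (4, (5, 10)); (4, (9, 26)); (4, (9, 28))];
      ArcData 43 [:: 3] 4 1 0 1 [:: (4, (32, 17)); (4, (39, 17)); (4, (36, 36)); (4, (4, 23))];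
      ArcData 47 [:: 5] 6 1 1 1 [:: (6, (40, 29)); (6, (17, 28)); (6, (44, 36))];
      ArcData 7 [:: 4; 6] 4 13 15 25 [:: (4, (8, 29)); (4, (34, 19)); (4, (4, 27)); (4, (39, 27)); (2, (13, 15))];
      ArcData 53 [:: 2] 9 1 3 1 [:: (9, (28, 35)); (9, (27, 50))];
      ArcData 59 [:: 2] 5 1 13 1 [:: (5, (14, 32)); (5, (44, 6)); (5, (22, 27)); (5, (40, 28))];
      ArcData 61 [:: 2] 5 13 24 25 [:: (5, (43, 43)); (5, (59, 20)); (5, (47, 54)); (5, (41, 55))];
      ArcData 2 [:: 1; 1; 0; 0; 0; 0] 9 8 27 15 [:: (9, (10, 23)); (9, (39, 13))];
      ArcData 67 [:: 2] 11 7 35 13 [:: (11, (10, 48)); (11, (29, 17))];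
      ArcData 71 [:: 7] 12 1 14 1 [:: (12, (27, 24)); (12, (45, 11))];
      ArcData 73 [:: 5] 6 13 10 25 [:: (6, (65, 57)); (6, (19, 17)); (6, (9, 53)); (6, (53, 23))];
      ArcData 79 [:: 3] 13 7 33 13 [:: (13, (11, 66)); (13, (74, 5))];
      ArcData 3 [:: 1; 2; 0; 0] 5 17 59 33 [:: (5, (64, 21)); (5, (38, 1)); (5, (8, 57)); (5, (34, 20)); (5, (46, 66))];
      ArcData 83 [:: 2] 4 1 0 1 [:: (4, (21, 67)); (2, (29, 0)); (4, (25, 28)); (4, (9, 27)); (4, (53, 55)); (4, (80, 50)); (4, (33, 56))];
      ArcData 89 [:: 3] 9 1 66 1 [:: (9, (51, 77)); (9, (58, 47)); (9, (44, 68))];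
      ArcData 97 [:: 5] 7 1 3 1 [:: (7, (18, 48)); (7, (74, 78)); (7, (62, 40)); (7, (84, 39))];
      ArcData 101 [:: 2] 10 11 94 21 [:: (10, (99, 43)); (10, (37, 58)); (10, (45, 59))];
      ArcData 103 [:: 5] 6 18 29 35 [:: (6, (98, 49)); (6, (48, 12)); (6, (10, 12)); (6, (11, 33)); (6, (43, 15))];
      ArcData 107 [:: 2] 6 1 1 1 [:: (6, (2, 26)); (6, (52, 44)); (6, (9, 14)); (6, (8, 31)); (6, (16, 43))];
      ArcData 109 [:: 6] 4 28 43 55 [:: (4, (81, 83)); (4, (54, 34)); (4, (101, 39)); (4, (83, 34)); (4, (75, 78)); (4, (16, 61)); (4, (11, 3)); (4, (46, 20))];
      ArcData 113 [:: 3] 8 15 100 29 [:: (8, (42, 96)); (8, (13, 40)); (8, (86, 82)); (8, (22, 108))];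
      ArcData 11 [:: 4; 10] 8 16 20 31 [:: (8, (94, 25)); (8, (83, 113)); (8, (114, 60)); (8, (33, 71))];
      ArcData 5 [:: 3; 2; 0] 7 1 105 1 [:: (7, (121, 105)); (7, (21, 91)); (7, (124, 116)); (7, (21, 13)); (7, (10, 59))];
      ArcData 127 [:: 3] 18 8 114 15 [:: (18, (74, 75)); (18, (78, 6))];
      ArcData 2 [:: 1; 1; 0; 0; 0; 0; 0] 3 1 1 1 [:: (3, (46, 65)); (3, (17, 63)); (3, (6, 18)); (3, (101, 7)); (3, (24, 101)); (3, (68, 10)); (3, (100, 46)); (3, (4, 43)); (3, (9, 122)); (3, (39, 127)); (3, (30, 85)); (3, (49, 33))];
      ArcData 131 [:: 2] 12 1 37 1 [:: (12, (116, 37)); (12, (51, 109)); (12, (84, 22))];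
      ArcData 137 [:: 3] 6 1 1 1 [:: (6, (92, 89)); (6, (84, 33)); (6, (21, 61)); (6, (1, 91)); (6, (15, 107)); (6, (55, 50))];
      ArcData 139 [:: 2] 7 1 87 1 [:: (7, (63, 89)); (7, (91, 131)); (7, (106, 49)); (7, (58, 22)); (7, (29, 89))];
      ArcData 149 [:: 2] 4 38 20 75 [:: (4, (133, 144)); (4, (3, 88)); (4, (29, 33)); (4, (138, 67)); (2, (38, 89)); (4, (84, 121)); (4, (66, 96)); (4, (27, 135)); (4, (18, 46)); (4, (80, 67))];
      ArcData 151 [:: 6] 19 1 61 1 [:: (19, (96, 89)); (19, (99, 147))];
      ArcData 157 [:: 5] 13 13 90 49 [:: (13, (8, 126)); (13, (75, 15)); (13, (149, 132))];
      ArcData 163 [:: 2] 6 28 146 55 [:: (6, (114, 157)); (6, (56, 92)); (6, (110, 64)); (6, (8, 10)); (6, (61, 65)); (6, (71, 135)); (6, (30, 68))];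
      ArcData 167 [:: 5] 21 1 54 1 [:: (21, (163, 158)); (21, (47, 102))];
      ArcData 13 [:: 11; 12] 21 9 58 17 [:: (21, (12, 113)); (21, (166, 37))];
      ArcData 173 [:: 2] 6 1 1 1 [:: (6, (121, 87)); (6, (52, 50)); (6, (57, 170)); (6, (76, 124)); (6, (136, 8)); (6, (54, 131)); (6, (84, 139))];
      ArcData 179 [:: 2] 20 1 5 1 [:: (20, (4, 165)); (20, (73, 155))];
      ArcData 181 [:: 2] 14 1 45 1 [:: (14, (8, 179)); (14, (133, 79)); (14, (85, 172))];
      ArcData 191 [:: 19] 5 39 183 77 [:: (5, (4, 22)); (5, (99, 11)); (5, (138, 136)); (5, (135, 172)); (5, (37, 172)); (5, (7, 136)); (5, (87, 166)); (5, (120, 75)); (5, (102, 130))];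
      ArcData 193 [:: 5] 4 49 42 97 [:: (2, (49, 126)); (4, (182, 120)); (4, (174, 4)); (4, (28, 132)); (4, (191, 60)); (4, (117, 150)); (4, (185, 157)); (4, (5, 58)); (4, (93, 109)); (4, (158, 42)); (4, (98, 13)); (4, (10, 154))];
      ArcData 197 [:: 2] 11 1 108 1 [:: (11, (49, 81)); (11, (76, 138)); (11, (64, 120)); (11, (170, 170))];
      ArcData 199 [:: 3] 11 19 53 37 [:: (11, (78, 91)); (11, (160, 71)); (11, (151, 47)); (11, (159, 5))];
      ArcData 211 [:: 2] 7 31 83 91 [:: (7, (129, 127)); (7, (9, 61)); (7, (41, 84)); (7, (47, 74)); (7, (161, 185)); (7, (107, 51)); (7, (104, 183))];
      ArcData 223 [:: 3] 16 1 184 1 [:: (16, (123, 199)); (16, (84, 154)); (16, (87, 111))];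
      ArcData 227 [:: 2] 12 1 24 1 [:: (12, (95, 154)); (12, (69, 140)); (12, (83, 208)); (12, (142, 184))];
      ArcData 229 [:: 6] 23 1 189 1 [:: (23, (53, 95)); (23, (37, 172))];
      ArcData 233 [:: 3] 26 1 2 1 [:: (26, (223, 127)); (26, (109, 33))];
      ArcData 239 [:: 7] 17 15 104 29 [:: (17, (22, 203)); (17, (64, 211)); (17, (72, 132))];
      ArcData 241 [:: 7] 2 121 0 1 [:: (2, (209, 66)); (2, (116, 134)); (2, (170, 192)); (2, (23, 89)); (2, (28, 144)); (2, (218, 29)); (2, (207, 191)); (2, (187, 162)); (2, (129, 100)); (2, (170, 72)); (2, (119, 45)); (2, (113, 92)); (2, (55, 96)); (2, (214, 237)); (2, (46, 29)); (2, (35, 105)); (2, (209, 186)); (2, (163, 39)); (2, (199, 87)); (2, (123, 47)); (2, (43, 9)); (2, (23, 209)); (2, (116, 14)); (2, (163, 159)); (2, (196, 104)); (2, (218, 149))];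
      ArcData 3 [:: 2; 1; 0; 0; 0] 22 12 116 23 [:: (22, (56, 36)); (22, (155, 131))];
      ArcData 251 [:: 6] 25 11 168 21 [:: (25, (138, 75)); (25, (248, 12))];
      ArcData 2 [:: 1; 0; 1; 1; 1; 0; 0; 0] 5 52 239 103 [:: (5, (174, 21)); (5, (242, 63)); (5, (207, 44)); (5, (100, 17)); (5, (137, 78)); (5, (97, 85)); (5, (162, 167)); (5, (26, 120)); (5, (222, 47)); (5, (186, 62)); (5, (197, 180))];
      ArcData 257 [:: 3] 6 1 1 1 [:: (6, (185, 192)); (6, (227, 1)); (6, (193, 106)); (6, (83, 136)); (6, (234, 24)); (6, (132, 182)); (6, (34, 175)); (6, (102, 178)); (6, (191, 153))];
      ArcData 263 [:: 5] 11 1 10 1 [:: (11, (54, 59)); (11, (36, 78)); (11, (231, 43)); (11, (216, 260)); (11, (150, 24))];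
      ArcData 269 [:: 2] 27 1 134 1 [:: (27, (9, 168)); (27, (3, 13))];
      ArcData 271 [:: 6] 8 1 78 1 [:: (8, (235, 35)); (8, (240, 4)); (8, (188, 34)); (8, (122, 197)); (8, (125, 51)); (8, (215, 159)); (8, (169, 99))];
      ArcData 277 [:: 5] 4 70 109 139 [:: (4, (134, 148)); (4, (104, 241)); (4, (180, 157)); (4, (196, 102)); (4, (202, 260)); (4, (102, 38)); (4, (159, 137)); (4, (168, 29)); (4, (131, 26)); (2, (70, 189)); (4, (183, 198)); (4, (268, 82)); (4, (46, 35)); (4, (270, 120)); (4, (179, 153))];
      ArcData 281 [:: 3] 14 21 12 41 [:: (14, (16, 8)); (14, (93, 173)); (14, (273, 55)); (14, (81, 211))];
      ArcData 283 [:: 3] 4 1 0 1 [:: (2, (217, 0)); (4, (231, 84)); (4, (16, 87)); (4, (241, 257)); (4, (79, 16)); (4, (155, 52)); (4, (159, 17)); (4, (39, 15)); (4, (203, 52)); (4, (40, 270)); (4, (173, 125)); (4, (131, 209)); (4, (226, 115)); (4, (106, 54)); (4, (48, 101))];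
      ArcData 17 [:: 14; 16] 29 1 162 1 [:: (29, (62, 195)); (29, (237, 140))];
      ArcData 293 [:: 2] 14 1 5 1 [:: (14, (251, 123)); (14, (30, 36)); (14, (226, 10)); (14, (60, 268))];
      ArcData 307 [:: 5] 28 1 47 1 [:: (28, (205, 134)); (28, (304, 192))];
      ArcData 311 [:: 17] 31 11 260 21 [:: (31, (82, 207)); (31, (82, 137))];
      ArcData 313 [:: 10] 4 79 177 157 [:: (4, (44, 106)); (4, (116, 239)); (4, (142, 154)); (4, (162, 34)); (4, (118, 140)); (4, (270, 48)); (4, (235, 181)); (2, (79, 59)); (4, (233, 260)); (4, (21, 121)); (4, (166, 135)); (4, (288, 70)); (4, (256, 157)); (4, (149, 44)); (4, (190, 120)); (4, (176, 272))];
      ArcData 317 [:: 2] 4 80 199 159 [:: (4, (8, 267)); (4, (28, 188)); (4, (31, 106)); (4, (283, 118)); (4, (297, 273)); (4, (259, 107)); (4, (242, 252)); (4, (310, 231)); (4, (188, 110)); (4, (154, 112)); (2, (80, 236)); (4, (105, 234)); (4, (302, 75)); (4, (105, 135)); (4, (5, 149)); (4, (289, 21))];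
      ArcData 331 [:: 3] 15 23 98 45 [:: (15, (295, 158)); (15, (104, 326)); (15, (129, 232)); (15, (32, 155))];
      ArcData 337 [:: 10] 21 17 287 81 [:: (21, (323, 308)); (21, (258, 307)); (21, (266, 262))];
      ArcData 7 [:: 5; 4; 0] 6 58 172 115 [:: (6, (6, 123)); (6, (238, 144)); (6, (315, 159)); (6, (205, 29)); (6, (231, 3)); (6, (82, 53)); (6, (225, 153)); (6, (247, 101)); (6, (265, 10)); (6, (314, 276)); (6, (196, 280))];
      ArcData 347 [:: 2] 29 1 4 1 [:: (29, (137, 195)); (29, (192, 245))];
      ArcData 349 [:: 2] 6 59 217 117 [:: (6, (199, 295)); (6, (234, 296)); (6, (229, 59)); (6, (264, 28)); (6, (94, 117)); (6, (146, 122)); (6, (112, 144)); (6, (104, 196)); (6, (316, 118)); (6, (39, 319)); (6, (77, 239))];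
      ArcData 353 [:: 3] 22 17 320 49 [:: (22, (70, 177)); (22, (87, 125)); (22, (235, 96))];
      ArcData 359 [:: 7] 4 1 0 1 [:: (4, (125, 316)); (4, (142, 244)); (4, (141, 160)); (4, (134, 326)); (4, (155, 219)); (4, (256, 101)); (4, (37, 95)); (4, (332, 91)); (4, (312, 312)); (4, (170, 306)); (4, (232, 345)); (4, (305, 351)); (4, (233, 209)); (4, (28, 175)); (4, (146, 77)); (4, (199, 220)); (4, (275, 27))];
      ArcData 19 [:: 17; 18] 3 1 181 1 [:: (3, (295, 158)); (3, (65, 327)); (3, (234, 72)); (3, (190, 30)); (1, (61, 0)); (3, (256, 229)); (3, (19, 166)); (3, (78, 126)); (3, (216, 48)); (3, (237, 36)); (3, (79, 207)); (3, (208, 41)); (3, (246, 301)); (3, (125, 168)); (3, (292, 312)); (3, (47, 275)); (3, (120, 265)); (3, (36, 159)); (3, (139, 212)); (1, (301, 0)); (3, (10, 350)); (3, (350, 273)); (3, (156, 222)); (3, (312, 251))];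
      ArcData 367 [:: 6] 23 1 88 1 [:: (23, (100, 278)); (23, (308, 349)); (23, (262, 244))];
      ArcData 373 [:: 2] 34 1 260 1 [:: (34, (49, 87)); (34, (220, 123))];
      ArcData 379 [:: 2] 14 28 85 55 [:: (14, (249, 255)); (14, (211, 230)); (14, (299, 243)); (14, (275, 214)); (14, (23, 269))];
      ArcData 383 [:: 5] 4 1 0 1 [:: (4, (200, 160)); (4, (3, 200)); (4, (165, 15)); (4, (114, 123)); (4, (132, 356)); (4, (201, 81)); (4, (155, 120)); (4, (198, 10)); (4, (342, 298)); (4, (319, 115)); (4, (66, 135)); (4, (264, 173)); (4, (246, 312)); (4, (182, 27)); (2, (160, 0)); (4, (303, 326)); (4, (350, 325)); (4, (241, 148))];
      ArcData 389 [:: 2] 10 1 266 1 [:: (10, (388, 61)); (10, (378, 363)); (10, (387, 215)); (10, (340, 189)); (10, (205, 360)); (10, (27, 321)); (10, (326, 380))];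
      ArcData 397 [:: 5] 18 23 322 45 [:: (18, (14, 206)); (18, (313, 217)); (18, (143, 93)); (18, (64, 183))];
      ArcData 401 [:: 3] 10 41 116 81 [:: (10, (320, 76)); (10, (381, 24)); (10, (210, 333)); (10, (136, 327)); (10, (317, 372)); (10, (118, 383)); (10, (200, 231))];
      ArcData 409 [:: 21] 24 18 17 35 [:: (24, (70, 405)); (24, (404, 109)); (24, (356, 134))];
      ArcData 419 [:: 2] 35 1 274 1 [:: (35, (33, 396)); (35, (301, 171))];
      ArcData 421 [:: 2] 15 29 412 57 [:: (15, (397, 59)); (15, (278, 354)); (15, (142, 353)); (15, (347, 48)); (15, (357, 211))];
      ArcData 431 [:: 7] 24 1 413 1 [:: (24, (38, 217)); (24, (250, 292)); (24, (235, 18))];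
      ArcData 433 [:: 5] 7 1 68 1 [:: (7, (345, 350)); (7, (4, 38)); (7, (230, 44)); (7, (390, 309)); (7, (337, 106)); (7, (349, 26)); (7, (253, 164)); (7, (359, 398)); (7, (259, 40)); (7, (216, 218)); (7, (245, 364))];
      ArcData 439 [:: 15] 11 1 105 1 [:: (11, (254, 276)); (11, (20, 141)); (11, (261, 49)); (11, (36, 420)); (11, (330, 387)); (11, (120, 116)); (11, (305, 55))];
      ArcData 443 [:: 2] 37 1 244 1 [:: (37, (138, 209)); (37, (167, 298))];
      ArcData 449 [:: 3] 25 1 315 1 [:: (25, (216, 99)); (25, (80, 172)); (25, (416, 271))];
      ArcData 457 [:: 13] 38 13 3 25 [:: (38, (246, 416)); (38, (299, 171))];
      ArcData 461 [:: 2] 20 24 270 47 [:: (20, (338, 305)); (20, (263, 186)); (20, (13, 343)); (20, (62, 136))];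
      ArcData 463 [:: 3] 16 1 58 1 [:: (16, (431, 227)); (16, (53, 52)); (16, (292, 372)); (16, (331, 308)); (16, (408, 314))];
      ArcData 467 [:: 2] 39 1 4 1 [:: (39, (319, 122)); (39, (91, 298))];
      ArcData 479 [:: 13] 40 1 197 1 [:: (40, (441, 309)); (40, (137, 64))];
      ArcData 487 [:: 3] 27 19 52 37 [:: (27, (287, 73)); (27, (62, 468)); (27, (247, 231))];
      ArcData 491 [:: 2] 41 1 323 1 [:: (41, (249, 447)); (41, (487, 94))];
      ArcData 499 [:: 7] 20 1 210 1 [:: (20, (470, 254)); (20, (217, 196)); (20, (59, 363)); (20, (112, 380))];
      ArcData 503 [:: 5] 42 1 209 1 [:: (42, (145, 15)); (42, (201, 247))];
      ArcData 509 [:: 2] 17 1 3 1 [:: (17, (183, 258)); (17, (186, 39)); (17, (476, 160)); (17, (175, 129)); (17, (110, 303))];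
      ArcData 2 [:: 1; 0; 0; 0; 1; 0; 0; 0; 0] 7 74 220 147 [:: (7, (501, 202)); (7, (98, 110)); (7, (36, 162)); (7, (454, 408)); (7, (231, 436)); (7, (502, 387)); (7, (176, 39)); (7, (51, 503)); (7, (346, 42)); (7, (323, 481)); (7, (105, 6)); (7, (324, 201))];
      ArcData 521 [:: 3] 4 131 485 261 [:: (4, (276, 406)); (4, (23, 163)); (4, (480, 471)); (4, (445, 520)); (4, (480, 270)); (4, (376, 390)); (4, (287, 15)); (4, (62, 154)); (4, (293, 30)); (4, (507, 101)); (4, (228, 320)); (4, (445, 53)); (4, (122, 318)); (4, (389, 362)); (4, (138, 358)); (4, (139, 57)); (4, (175, 31)); (4, (125, 323)); (4, (292, 10)); (4, (21, 374)); (2, (131, 286)); (4, (448, 186))];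
      ArcData 523 [:: 2] 4 1 0 1 [:: (4, (394, 180)); (4, (464, 245)); (4, (178, 181)); (4, (216, 368)); (4, (132, 287)); (2, (388, 0)); (4, (432, 520)); (4, (348, 9)); (4, (381, 352)); (4, (485, 179)); (4, (235, 336)); (4, (143, 41)); (4, (427, 250)); (4, (507, 314)); (4, (275, 77)); (4, (83, 259)); (4, (494, 311)); (4, (332, 109)); (4, (320, 197)); (4, (493, 436)); (4, (67, 236)); (4, (258, 507))];
      ArcData 23 [:: 16; 22] 12 45 503 89 [:: (12, (434, 437)); (12, (226, 170)); (12, (282, 108)); (12, (378, 10)); (12, (88, 316)); (12, (395, 465)); (12, (192, 177))];
      ArcData 541 [:: 2] 3 1 271 1 [:: (3, (364, 26)); (3, (135, 226)); (3, (386, 403)); (3, (417, 226)); (3, (106, 178)); (3, (100, 206)); (3, (201, 9)); (3, (19, 468)); (3, (424, 275)); (3, (303, 48)); (3, (251, 253)); (3, (384, 9)); (3, (505, 286)); (3, (195, 525)); (3, (380, 253)); (3, (173, 54)); (3, (41, 459)); (3, (318, 157)); (3, (413, 398)); (3, (514, 147)); (3, (280, 522)); (3, (168, 258)); (3, (473, 385)); (3, (220, 408)); (3, (431, 228)); (3, (374, 95)); (1, (91, 0)); (3, (382, 201)); (3, (448, 457)); (3, (77, 246))];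
      ArcData 547 [:: 2] 21 27 332 53 [:: (21, (370, 461)); (21, (415, 16)); (21, (196, 351)); (21, (342, 52))];
      ArcData 557 [:: 2] 18 1 382 1 [:: (18, (469, 192)); (18, (431, 461)); (18, (287, 280)); (18, (83, 114)); (18, (337, 331))];
      ArcData 563 [:: 2] 6 1 1 1 [:: (6, (418, 303)); (6, (409, 133)); (6, (482, 324)); (6, (450, 283)); (6, (478, 207)); (6, (169, 19)); (6, (153, 141)); (6, (315, 132)); (6, (380, 282)); (6, (429, 496)); (6, (27, 99)); (6, (64, 536)); (6, (151, 220)); (6, (22, 204)); (6, (295, 71))];
      ArcData 569 [:: 3] 30 1 397 1 [:: (30, (161, 79)); (30, (304, 335)); (30, (466, 247))];
      ArcData 571 [:: 3] 44 1 275 1 [:: (44, (41, 398)); (44, (443, 156))];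
      ArcData 577 [:: 5] 18 33 26 65 [:: (18, (567, 170)); (18, (183, 68)); (18, (74, 306)); (18, (491, 215)); (18, (97, 133))];
      ArcData 587 [:: 2] 7 1 519 1 [:: (7, (196, 495)); (7, (516, 26)); (7, (134, 462)); (7, (333, 103)); (7, (396, 107)); (7, (370, 279)); (7, (115, 327)); (7, (538, 394)); (7, (554, 523)); (7, (419, 100)); (7, (326, 83)); (7, (346, 27)); (7, (251, 466))];
      ArcData 593 [:: 3] 22 1 427 1 [:: (22, (35, 317)); (22, (523, 343)); (22, (163, 492)); (22, (569, 90))];
      ArcData 599 [:: 7] 30 1 35 1 [:: (30, (152, 164)); (30, (504, 171)); (30, (322, 207))];
      ArcData 601 [:: 7] 43 1 401 1 [:: (43, (534, 592)); (43, (598, 545))];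
      ArcData 607 [:: 3] 19 1 565 1 [:: (19, (189, 11)); (19, (401, 14)); (19, (335, 349)); (19, (386, 256)); (19, (365, 174))];
      ArcData 613 [:: 2] 12 52 298 103 [:: (12, (195, 105)); (12, (467, 564)); (12, (361, 521)); (12, (232, 57)); (12, (175, 125)); (12, (551, 349)); (12, (344, 422)); (12, (34, 476))];
      ArcData 617 [:: 3] 8 78 359 155 [:: (8, (547, 547)); (8, (255, 520)); (8, (331, 425)); (8, (609, 454)); (8, (314, 95)); (8, (27, 318)); (8, (389, 534)); (8, (591, 60)); (8, (177, 360)); (8, (70, 499)); (8, (530, 520)); (8, (85, 67))];
      ArcData 619 [:: 2] 31 1 521 1 [:: (31, (87, 323)); (31, (467, 603)); (31, (178, 92))];
      ArcData 5 [:: 3; 3; 4; 0] 48 14 47 27 [:: (48, (586, 440)); (48, (264, 564))];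
      ArcData 631 [:: 3] 8 1 365 1 [:: (8, (163, 160)); (8, (418, 323)); (8, (449, 116)); (8, (51, 274)); (8, (89, 373)); (8, (400, 543)); (8, (323, 519)); (8, (149, 317)); (8, (561, 9)); (8, (26, 238)); (8, (611, 82)); (8, (542, 180))];
      ArcData 641 [:: 3] 32 21 342 61 [:: (32, (536, 440)); (32, (233, 343)); (32, (484, 47))];
      ArcData 643 [:: 11] 46 1 413 1 [:: (46, (306, 30)); (46, (230, 29))];
      ArcData 647 [:: 5] 24 1 583 1 [:: (24, (112, 139)); (24, (490, 387)); (24, (350, 203)); (24, (84, 313))];
      ArcData 653 [:: 2] 3 1 327 1 [:: (3, (120, 388)); (3, (103, 161)); (3, (135, 326)); (3, (644, 412)); (3, (369, 465)); (3, (354, 425)); (3, (214, 250)); (3, (440, 24)); (3, (355, 387)); (3, (326, 99)); (3, (421, 403)); (3, (497, 550)); (3, (534, 129)); (3, (550, 155)); (3, (595, 519)); (3, (261, 179)); (3, (174, 521)); (3, (368, 263)); (3, (279, 83)); (3, (358, 627)); (3, (213, 234)); (3, (9, 8)); (3, (337, 462)); (3, (648, 569)); (3, (233, 142)); (3, (456, 328)); (3, (576, 249)); (3, (604, 250)); (3, (227, 56)); (3, (79, 320)); (3, (126, 385)); (3, (631, 244)); (3, (7, 410))];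
      ArcData 659 [:: 2] 47 15 97 29 [:: (47, (361, 565)); (47, (379, 285))];
      ArcData 661 [:: 2] 5 1 262 1 [:: (5, (638, 531)); (5, (398, 350)); (5, (410, 38)); (5, (480, 179)); (5, (186, 504)); (5, (289, 78)); (5, (520, 389)); (5, (129, 525)); (5, (602, 315)); (5, (627, 305)); (5, (122, 125)); (5, (14, 18)); (5, (445, 452)); (5, (256, 217)); (5, (625, 405)); (5, (551, 450)); (5, (50, 609)); (5, (229, 76))];
      ArcData 673 [:: 5] 32 22 426 64 [:: (32, (374, 122)); (32, (648, 291)); (32, (454, 268))];
      ArcData 677 [:: 2] 6 1 1 1 [:: (6, (606, 599)); (6, (420, 68)); (6, (672, 144)); (6, (570, 474)); (6, (283, 565)); (6, (245, 469)); (6, (166, 503)); (6, (5, 169)); (6, (401, 629)); (6, (197, 34)); (6, (374, 617)); (6, (20, 442)); (6, (364, 348)); (6, (274, 44)); (6, (589, 222)); (6, (299, 232)); (6, (24, 630))];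
      ArcData 683 [:: 5] 19 1 639 1 [:: (19, (666, 126)); (19, (220, 255)); (19, (240, 65)); (19, (424, 370)); (19, (491, 177))];
      ArcData 691 [:: 3] 10 70 605 208 [:: (10, (600, 108)); (10, (529, 110)); (10, (660, 679)); (10, (57, 494)); (10, (169, 73)); (10, (222, 55)); (10, (354, 433)); (10, (467, 614)); (10, (497, 479)); (10, (87, 543))];
      ArcData 701 [:: 2] 26 1 439 1 [:: (26, (62, 315)); (26, (226, 279)); (26, (26, 101)); (26, (436, 683))];
      ArcData 709 [:: 2] 3 1 355 1 [:: (3, (59, 290)); (3, (590, 706)); (3, (125, 422)); (3, (563, 85)); (3, (321, 574)); (3, (38, 165)); (3, (278, 187)); (3, (51, 304)); (3, (431, 232)); (3, (171, 707)); (3, (416, 434)); (3, (621, 46)); (3, (56, 503)); (3, (173, 195)); (3, (470, 457)); (3, (583, 619)); (3, (296, 426)); (3, (358, 315)); (3, (496, 691)); (3, (362, 655)); (3, (549, 550)); (3, (303, 202)); (3, (362, 54)); (3, (450, 45)); (3, (512, 332)); (3, (85, 321)); (3, (700, 601)); (3, (525, 415)); (3, (532, 236)); (3, (345, 76)); (3, (287, 516)); (3, (431, 245)); (3, (264, 120)); (3, (90, 346))];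
      ArcData 719 [:: 11] 20 1 419 1 [:: (20, (598, 469)); (20, (637, 329)); (20, (607, 131)); (20, (549, 700)); (20, (567, 659))];
      ArcData 727 [:: 5] 52 1 2 1 [:: (52, (608, 299)); (52, (267, 127))];
      ArcData 3 [:: 1; 2; 0; 0; 0; 0] 52 15 51 29 [:: (52, (388, 468)); (52, (543, 47))];
      ArcData 733 [:: 6] 4 184 619 367 [:: (4, (227, 179)); (4, (310, 152)); (4, (659, 27)); (4, (136, 622)); (4, (689, 559)); (4, (96, 692)); (4, (482, 511)); (4, (60, 7)); (4, (219, 105)); (4, (510, 155)); (4, (139, 690)); (4, (228, 205)); (4, (502, 89)); (4, (24, 504)); (4, (91, 474)); (4, (276, 416)); (4, (206, 82)); (4, (598, 557)); (4, (200, 162)); (4, (564, 80)); (4, (237, 499)); (4, (3, 145)); (4, (635, 375)); (4, (331, 279)); (4, (593, 466)); (4, (54, 75)); (2, (184, 603))];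
      ArcData 739 [:: 3] 3 1 370 1 [:: (3, (97, 143)); (3, (439, 460)); (3, (181, 713)); (3, (412, 36)); (3, (737, 586)); (3, (638, 403)); (3, (386, 689)); (3, (645, 406)); (3, (285, 627)); (3, (101, 592)); (3, (475, 5)); (1, (616, 0)); (3, (481, 667)); (3, (278, 458)); (3, (561, 633)); (3, (541, 625)); (3, (483, 460)); (3, (368, 243)); (3, (700, 37)); (3, (428, 13)); (3, (183, 297)); (3, (105, 653)); (3, (583, 658)); (3, (672, 358)); (3, (160, 13)); (3, (465, 193)); (3, (307, 266)); (3, (254, 357)); (3, (690, 124)); (3, (545, 62)); (3, (492, 349)); (3, (164, 645)); (3, (233, 112)); (3, (181, 66)); (3, (236, 78)); (3, (576, 383))];
      ArcData 743 [:: 5] 53 15 431 29 [:: (53, (717, 382)); (53, (75, 702))];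
      ArcData 751 [:: 3] 15 51 293 101 [:: (15, (382, 205)); (15, (631, 313)); (15, (202, 325)); (15, (641, 638)); (15, (561, 202)); (15, (160, 308)); (15, (167, 540))];
      ArcData 757 [:: 2] 54 15 574 29 [:: (54, (738, 626)); (54, (355, 372))];
      ArcData 761 [:: 6] 6 1 1 1 [:: (6, (593, 430)); (6, (443, 64)); (6, (215, 254)); (6, (448, 189)); (6, (503, 594)); (6, (203, 398)); (6, (423, 374)); (6, (213, 605)); (6, (176, 435)); (6, (696, 49)); (6, (656, 99)); (6, (284, 623)); (6, (260, 297)); (6, (607, 608)); (6, (399, 474)); (6, (199, 22)); (6, (611, 502)); (6, (417, 754))];
      ArcData 769 [:: 11] 55 1 32 1 [:: (55, (305, 565)); (55, (25, 653))];
      ArcData 773 [:: 2] 18 1 240 1 [:: (18, (341, 733)); (18, (217, 731)); (18, (682, 42)); (18, (563, 212)); (18, (168, 257)); (18, (25, 628))];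
      ArcData 787 [:: 2] 3 1 394 1 [:: (3, (127, 1)); (3, (464, 330)); (3, (619, 589)); (3, (396, 307)); (3, (530, 248)); (3, (155, 147)); (3, (269, 300)); (3, (192, 732)); (3, (318, 472)); (3, (122, 750)); (3, (47, 139)); (3, (577, 277)); (3, (351, 606)); (3, (554, 617)); (3, (617, 703)); (3, (726, 760)); (3, (681, 28)); (3, (189, 626)); (3, (697, 647)); (3, (426, 125)); (3, (402, 447)); (3, (293, 692)); (3, (594, 613)); (3, (257, 226)); (3, (625, 107)); (3, (683, 51)); (3, (315, 361)); (3, (180, 365)); (3, (686, 578)); (3, (98, 144)); (3, (35, 365)); (3, (399, 239)); (3, (350, 691)); (3, (65, 377)); (3, (198, 676)); (3, (722, 495))];
      ArcData 797 [:: 2] 14 1 456 1 [:: (14, (106, 584)); (14, (227, 737)); (14, (291, 780)); (14, (300, 514)); (14, (238, 253)); (14, (430, 374)); (14, (437, 547)); (14, (190, 383))];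
      ArcData 809 [:: 3] 54 1 758 1 [:: (54, (339, 144)); (54, (361, 95))];
      ArcData 811 [:: 3] 28 1 497 1 [:: (28, (562, 443)); (28, (153, 516)); (28, (809, 262)); (28, (742, 50))];
      ArcData 821 [:: 2] 6 1 1 1 [:: (6, (251, 101)); (6, (634, 382)); (6, (656, 203)); (6, (388, 64)); (6, (569, 528)); (6, (445, 168)); (6, (464, 24)); (6, (406, 719)); (6, (804, 185)); (6, (162, 265)); (6, (712, 430)); (6, (368, 11)); (6, (212, 482)); (6, (52, 155)); (6, (53, 341)); (6, (565, 672)); (6, (598, 20)); (6, (267, 222)); (6, (422, 161))];
      ArcData 823 [:: 3] 3 1 412 1 [:: (3, (281, 1)); (3, (822, 582)); (3, (598, 346)); (3, (494, 266)); (3, (143, 672)); (3, (673, 377)); (3, (433, 446)); (3, (696, 809)); (3, (324, 344)); (3, (588, 129)); (3, (205, 309)); (3, (771, 710)); (3, (301, 531)); (3, (615, 378)); (3, (652, 62)); (3, (38, 134)); (3, (650, 545)); (3, (609, 500)); (3, (472, 602)); (3, (133, 245)); (3, (380, 240)); (3, (816, 228)); (3, (181, 79)); (3, (132, 534)); (3, (210, 746)); (3, (211, 172)); (3, (675, 370)); (3, (341, 510)); (3, (779, 150)); (3, (483, 647)); (3, (16, 120)); (3, (21, 773)); (3, (711, 561)); (3, (452, 219)); (3, (754, 724)); (3, (666, 436)); (3, (103, 515)); (3, (124, 680))];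
      ArcData 827 [:: 2] 36 1 200 1 [:: (36, (78, 189)); (36, (193, 295)); (36, (539, 30))];
      ArcData 829 [:: 2] 23 37 307 73 [:: (23, (632, 618)); (23, (154, 551)); (23, (97, 42)); (23, (471, 626)); (23, (159, 675))];
      ArcData 839 [:: 11] 56 1 620 1 [:: (56, (279, 69)); (56, (617, 618))];
      ArcData 29 [:: 26; 28] 56 16 704 31 [:: (56, (273, 637)); (56, (441, 408))];
      ArcData 857 [:: 3] 39 1 753 1 [:: (39, (11, 439)); (39, (163, 611)); (39, (42, 782))];
      ArcData 31 [:: 19; 30] 10 97 225 865 [:: (10, (362, 310)); (10, (858, 146)); (10, (473, 40)); (10, (17, 680)); (10, (658, 609)); (10, (894, 785)); (10, (233, 271)); (10, (585, 292)); (10, (99, 230)); (10, (718, 8)); (10, (40, 212)); (10, (150, 479))];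
      ArcData 2 [:: 1; 0; 0; 1; 0; 0; 0; 0; 0; 0] 31 34 661 67 [:: (31, (926, 859)); (31, (504, 825)); (31, (833, 472)); (31, (325, 291))];
      ArcData 37 [:: 32; 36] 36 39 343 77 [:: (36, (983, 1009)); (36, (689, 144)); (36, (1151, 948)); (36, (1195, 794))];
      ArcData 41 [:: 29; 40] 40 43 547 1639 [:: (40, (1459, 958)); (40, (520, 362)); (40, (823, 130)); (40, (34, 1047))];
      ArcData 7 [:: 2; 4; 6; 0] 48 51 1451 2351 [:: (48, (2245, 575)); (48, (997, 1810)); (48, (313, 1127)); (48, (1855, 2330))]].

Local Close Scope N_scope.

(** * Numerical bounds *)

(** The inequality k + c < (a / d) sqrt q, cleared of d and squared, in binary numbers for fast
    evaluation. *)
Definition below (a d c q k : nat) : bool :=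
  let x := N.mul (N.of_nat d) (N.of_nat (k + c)) in
  N.ltb (N.mul x x) (N.mul (N.of_nat (a * a)) (N.of_nat q)).

Definition below_eq (a d c q k : nat) : bool :=
  let x := N.mul (N.of_nat d) (N.of_nat (k + c)) in
  N.leb (N.mul x x) (N.mul (N.of_nat (a * a)) (N.of_nat q)).

(** The clauses of the theorem in their order, decimals such as 3.6 being written as fractions. All
    are monotone in [k], so an arc of size [k] suffices. *)
Definition bounds_ok (q k : nat) : bool :=
  [&& [|| 2 <= q <= 841, q == 857 | q \in Qset] ==> below 4 1 0 q k,
      [|| 2 <= q <= 89 | q == 101] ==> below_eq 3 1 0 q k,
      (2 <= q <= 277) ==> below 7 2 0 q k,
      [|| 2 <= q <= 349 | q \in [:: 359; 661]] ==> below 18 5 0 q k,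
      [|| 2 <= q <= 419 | q \in [:: 601; 661]] ==> below 37 10 0 q k,
      [|| 2 <= q <= 541 | q \in [:: 601; 661]] ==> below 19 5 0 q k,
      [|| 2 <= q <= 673 | q \in [:: 729; 961; 1024]] ==> below 39 10 0 q k,
      [|| 37 <= q <= 211 | q \in [:: 23; 227; 229; 233; 241; 243; 256; 257; 661]] ==> below_eq 4 1 9 q k,
      [|| 23 <= q <= 307 | q \in [:: 317; 343; 601; 661]] ==> below_eq 4 1 8 q k,
      [|| 19 <= q <= 373 | q \in [:: 383; 401; 601; 661]] ==> below_eq 4 1 7 q k,
      [|| 9 <= q <= 433 | q \in [:: 443; 463; 601; 661]] ==> below_eq 4 1 6 q k,
      [|| 8 <= q <= 499 | q \in [:: 509; 512; 521; 523; 529; 541; 601; 661]] ==> below_eq 4 1 5 q k,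
      [|| 7 <= q <= 557, q \in [:: 569; 571; 577; 601; 625; 661; 729; 841] | q \in Qset] ==> below_eq 4 1 4 q k,
      [|| 7 <= q <= 643, q \in [:: 653; 661; 729; 841] | q \in Qset] ==> below 4 1 3 q k,
      [|| 3 <= q <= 691, q \in [:: 709; 719; 729; 841] | q \in Qset] ==> below_eq 4 1 2 q k
    & [|| 2 <= q <= 761, q \in [:: 773; 787; 841] | q \in Qset] ==> below 4 1 1 q k].

Definition in_range (q : nat) : bool := [|| 2 <= q <= 841, q == 857 | q \in Qset].

Definition range : seq nat := iota 2 840 ++ 857 :: Qset.

(** A computable test, which discards the orders in the range that no field has. *)
Definition prime_power (q : nat) : bool := q == pdiv q ^ logn (pdiv q) q.

Lemma mem_range q : in_range q -> q \in range.
Proof.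
rewrite /in_range /range mem_cat mem_iota => /or3P[le_q|/eqP->//|q_Q].
  by rewrite (_ : 2 <= q < 2 + 840) //; move: le_q; clear; lia.
by rewrite inE q_Q !orbT.
Qed.

Lemma card_prime_power (F : finFieldType) : prime_power #|F|.
Proof.
have [p pr_p charF] := finPcharP F.
rewrite /prime_power (card_pprimeChar charF); set n := logn p #|F|.
have n_gt0 : 0 < n.
  rewrite lt0n; apply/eqP => n0; have := finNzRing_gt1 F.
  by rewrite (card_pprimeChar charF) -/n n0.
by rewrite -(prednK n_gt0) pdiv_pfactor // pfactorK.
Qed.

Section Bounds.
Local Open Scope ring_scope.
Variables (a d c q k t : nat).
Hypothesis d_gt0 : (0 < d)%N.
Hypothesis le_tk : (t <= k)%N.
Let s := sqrtC (q%:R : algC).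

Let sqr_bound x y : ((x%:R : algC) <= y%:R * s) = (x ^ 2 <= y ^ 2 * q)%N.
Proof.
have s_ge0 : 0 <= s by rewrite sqrtC_ge0 ler0n.
rewrite -(@ler_pXn2r _ 2) ?nnegrE ?ler0n ?mulr_ge0 //.
by rewrite exprMn sqrtCK -!natrX -natrM ler_nat.
Qed.

Let sqr_sbound x y : ((x%:R : algC) < y%:R * s) = (x ^ 2 < y ^ 2 * q)%N.
Proof.
have s_ge0 : 0 <= s by rewrite sqrtC_ge0 ler0n.
rewrite -(@ltr_pXn2r _ 2) ?nnegrE ?ler0n ?mulr_ge0 //.
by rewrite exprMn sqrtCK -!natrX -natrM ltr_nat.
Qed.

Let scale_t : (t%:R + c%:R) * d%:R <= (d * (k + c))%:R :> algC.
Proof. by rewrite -natrD -natrM ler_nat mulnC leq_mul2l leq_add2r le_tk orbT. Qed.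

Lemma below_eqP : below_eq a d c q k -> t%:R <= a%:R / d%:R * s - c%:R.
Proof.
rewrite /below_eq => b; rewrite lerBrDr.
rewrite -(@ler_pM2r _ d%:R) ?ltr0n // mulrAC divfK ?pnatr_eq0 ?gtn_eqF //.
rewrite (le_trans scale_t) // sqr_bound !expnS !expn0 !muln1.
by move: b; case: N.leb_spec => // h _; move: h; lia.
Qed.

Lemma belowP : below a d c q k -> t%:R < a%:R / d%:R * s - c%:R.
Proof.
rewrite /below => b; rewrite ltrBrDr.
rewrite -(@ltr_pM2r _ d%:R) ?ltr0n // mulrAC divfK ?pnatr_eq0 ?gtn_eqF //.
rewrite (le_lt_trans scale_t) // sqr_sbound !expnS !expn0 !muln1.
by move: b; case: N.ltb_spec => // h _; move: h; lia.
Qed.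
End Bounds.

Lemma arcs_cover : all (fun q => has (fun x => arc_q x == q) arcs || ~~ prime_power q) range.
Proof. by vm_cast_no_check (erefl true). Qed.

Lemma arcs_bounds : all (fun x => bounds_ok (arc_q x) (arc_size x)) arcs.
Proof. by vm_cast_no_check (erefl true). Qed.

Lemma arcs_complete : all check_arc arcs.
Proof. by vm_cast_no_check (erefl true). Qed.

(** A single arc size k serves all the clauses for a given order. *)
Lemma bounds_t2 (F : finFieldType) : in_range #|F| -> exists2 k, (t2 F <= k)%N & bounds_ok #|F| k.
Proof.
move=> /mem_range/(allP arcs_cover)/orP[|]; last by rewrite card_prime_power.
pose x0 := ArcData 0 [::] 0 N0 N0 N0 [::].
case/(has_nthP x0)=> i lt_i /eqP cardF; exists (arc_size (nth x0 arcs i)).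
  by apply: check_arcP (esym cardF); apply: (all_nthP x0 arcs_complete).
by rewrite -cardF; apply: (all_nthP x0 arcs_bounds).
Qed.

Local Open Scope ring_scope.

Theorem theorem3 :
  (forall F : finFieldType, let q := #|F| in let t := (t2 F)%:R : algC in
     let s := sqrtC (q%:R : algC) in
     ([|| (2 <= q <= 841)%N, q == 857%N | q \in Qset] -> t < 4 * s)
  /\ ([|| (2 <= q <= 89)%N | q == 101%N] -> t <= 3 * s)
  /\ ((2 <= q <= 277)%N -> t < (7%:R / 2%:R) * s)
  /\ ([|| (2 <= q <= 349)%N | q \in [:: 359; 661]%N] -> t < (18%:R / 5%:R) * s)
  /\ ([|| (2 <= q <= 419)%N | q \in [:: 601; 661]%N] -> t < (37%:R / 10%:R) * s)
  /\ ([|| (2 <= q <= 541)%N | q \in [:: 601; 661]%N] -> t < (19%:R / 5%:R) * s)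
  /\ ([|| (2 <= q <= 673)%N | q \in [:: 729; 961; 1024]%N] -> t < (39%:R / 10%:R) * s)
  /\ ([|| (37 <= q <= 211)%N | q \in [:: 23; 227; 229; 233; 241; 243; 256; 257; 661]%N]
        -> t <= 4 * s - 9%:R)
  /\ ([|| (23 <= q <= 307)%N | q \in [:: 317; 343; 601; 661]%N] -> t <= 4 * s - 8%:R)
  /\ ([|| (19 <= q <= 373)%N | q \in [:: 383; 401; 601; 661]%N] -> t <= 4 * s - 7%:R)
  /\ ([|| (9 <= q <= 433)%N | q \in [:: 443; 463; 601; 661]%N] -> t <= 4 * s - 6%:R)
  /\ ([|| (8 <= q <= 499)%N | q \in [:: 509; 512; 521; 523; 529; 541; 601; 661]%N]
        -> t <= 4 * s - 5%:R)
  /\ ([|| (7 <= q <= 557)%N, q \in [:: 569; 571; 577; 601; 625; 661; 729; 841]%N | q \in Qset]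
        -> t <= 4 * s - 4%:R)
  /\ ([|| (7 <= q <= 643)%N, q \in [:: 653; 661; 729; 841]%N | q \in Qset]
        -> t < 4 * s - 3%:R)
  /\ ([|| (3 <= q <= 691)%N, q \in [:: 709; 719; 729; 841]%N | q \in Qset]
        -> t <= 4 * s - 2%:R)
  /\ ([|| (2 <= q <= 761)%N, q \in [:: 773; 787; 841]%N | q \in Qset]
        -> t < 4 * s - 1)).
Proof.
move=> F q t s.
have [|out] := boolP (in_range q); last first.
  (* Every clause has a premise implying [in_range], so outside the range all hold vacuously. *)
  have out_of (b : bool) (P : Prop) : (b -> in_range q) -> b -> P.
    by move=> bq /bq; rewrite (negPf out).
  by do ![split]; apply: out_of; rewrite /in_range /Qset !inE; clear; lia.
case/bounds_t2=> k le_k; rewrite -/q /bounds_ok.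
case/and5P=> /implyP c1 /implyP c2 /implyP c3 /implyP c4.
case/and5P=> /implyP c5 /implyP c6 /implyP c7 /implyP c8.
case/and5P=> /implyP c9 /implyP c10 /implyP c11 /implyP c12.
case/and4P=> /implyP c13 /implyP c14 /implyP c15 /implyP c16.
have lt0 a d (b : bool) : (0 < d)%N -> (b -> below a d 0 q k) -> b -> t < a%:R / d%:R * s.
  by move=> d_gt0 bP /bP/(belowP d_gt0 le_k); rewrite subr0.
have lt4 c (b : bool) : (b -> below 4 1 c q k) -> b -> t < 4 * s - c%:R.
  by move=> bP /bP/(belowP (ltn0Sn 0) le_k); rewrite divr1.
have le4 c (b : bool) : (b -> below_eq 4 1 c q k) -> b -> t <= 4 * s - c%:R.
  by move=> bP /bP/(below_eqP (ltn0Sn 0) le_k); rewrite divr1.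
split; first by move=> cond; have := lt4 0 _ c1 cond; rewrite subr0.
split; first by move=> /c2/(below_eqP (ltn0Sn 0) le_k); rewrite divr1 subr0.
split; first exact: lt0 c3.
split; first exact: lt0 c4.
split; first exact: lt0 c5.
split; first exact: lt0 c6.
split; first exact: lt0 c7.
split; first exact: le4 c8.
split; first exact: le4 c9.
split; first exact: le4 c10.
split; first exact: le4 c11.
split; first exact: le4 c12.
split; first exact: le4 c13.
split; first exact: lt4 c14.
split; first exact: le4 c15.
exact: lt4 1 _ c16.
Qed.
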